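(* Let $\theta>2$ and let $p,q\in[1,\infty]$ satisfy $\frac{\theta}{p}+\frac1q=1$. Let $1\le \alpha'\le \frac{2q}{q+1}$ (with $\frac{2q}{q+1}=2$ if $q=\infty$), and let $I\subset\mathbb R$ be a bounded interval. Then there is a constant $C=C(|I|,\theta)$ such that for every $N>1$, every orthonormal system $(f_j)_j$ in $L^2(\mathbb T)$ and every sequence $\lambda=(\lambda_j)_j\in\ell^{\alpha'}$, $$\Big\|\sum_j\lambda_j\,|e^{it(-\Delta)^{\theta/2}}P_{\le N}f_j|^2\Big\|_{L^p_tL^q_x(I\times\mathbb T)}\le C\,N^{\frac{\theta-1}{p}}\,\|\lambda\|_{\ell^{\alpha'}}.$$
   Context: $\mathbb T=\mathbb R/\mathbb Z$, with Fourier coefficients $\widehat f(\xi)=\int_{\mathbb T}f(x)e^{-2\pi i x\xi}\,dx$, $\xi\in\mathbb Z$. The fractional Schrödinger propagator $e^{it(-\Delta)^{\theta/2}}$ is the Fourier multiplier with symbol $e^{2\pi i t|\xi|^\theta}$. The frequency cut-off $P_{\le N}$ is the Fourier multiplier with symbol $\mathbf 1_{[-N,N]}(\xi)$. $\|F\|_{L^p_tL^q_x(I\times\mathbb T)}=\big\|\,\|F(t,\cdot)\|_{L^q(\mathbb T)}\big\|_{L^p(I)}$. *)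

(* Defs.v *)
From HB Require Import structures.
From mathcomp Require Import all_boot all_order all_algebra.
From mathcomp Require Import all_classical all_reals all_analysis.
From mathcomp Require Export complex.

Set Implicit Arguments.
Unset Strict Implicit.
Unset Printing Implicit Defensive.
Import Order.TTheory GRing.Theory Num.Theory.
Import numFieldNormedType.Exports.

Local Open Scope classical_set_scope.
Local Open Scope ring_scope.

Section complex_valued.
Context {R : realType}.
Implicit Types (f g : R -> R[i]) (z : R[i]).

Definition cexp (s : R) : R[i] := (cos s +i* sin s)%C.

(* Componentwise; meaningful when f is integrable on D. *)
Definition cintegral (D : set R) f : R[i] :=
  (Rintegral lebesgue_measure D (fun x => complex.Re (f x))
   +i* Rintegral lebesgue_measure D (fun x => complex.Im (f x)))%C.

(* Componentwise limit of the partial sums: the sum of the series in C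
   whenever it converges. *)
Definition cseries (u : nat -> R[i]) : R[i] :=
  (limn (series (fun j => complex.Re (u j)))
   +i* limn (series (fun j => complex.Im (u j))))%C.

End complex_valued.

Section torus.
Context {R : realType}.
Implicit Types (f g : R -> R[i]) (m : int -> R[i]).

Definition lebesgue_on (I : interval R) :
    {measure set (measurableTypeR R) -> \bar R} :=
  mrestr (@lebesgue_measure R) (measurable_itv I).

Definition torus : interval R := `[0, 1[.

(* Functions on R/Z are 1-periodic functions on R; an element of L^2 is
   given by any of its representatives. *)
Definition L2_torus f : Prop :=
  [/\ forall x, f (x + 1) = f x,
      measurable_fun setT (fun x => complex.Re (f x)),
      measurable_fun setT (fun x => complex.Im (f x)) &
      (\int[lebesgue_measure]_(x in [set` torus]) ((Normc.normc (f x) ^+ 2)%:E)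
        < +oo)%E].

Definition inner_torus f g : R[i] :=
  cintegral [set` torus] (fun x => f x * ((g x)^*)%C).

(* The system is indexed by a subset J of nat, so that finite systems are
   included. *)
Definition orthonormal_system (J : set nat) (f : nat -> R -> R[i]) : Prop :=
  (forall j, J j -> L2_torus (f j)) /\
  (forall j k, J j -> J k -> inner_torus (f j) (f k) = (j == k)%:R).

Definition fourier_coef f (xi : int) : R[i] :=
  cintegral [set` torus] (fun x => f x * cexp (- (2 * pi * x * xi%:~R))).

(* Meant for finitely supported symbols m: \sum_(_ \in _) is 0 by convention
   when infinitely many terms are nonzero. *)
Definition fourier_multiplier m f (x : R) : R[i] :=
  \sum_(xi \in [set: int])
    m xi * fourier_coef f xi * cexp (2 * pi * x * xi%:~R).

Definition schrodinger_symbol (theta t : R) (xi : int) : R[i] :=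
  cexp (2 * pi * t * (`|xi%:~R : R| `^ theta)).

Definition cutoff_symbol (N : R) (xi : int) : R[i] :=
  if - N <= xi%:~R <= N then 1 else 0.

(* e^{it(-Delta)^{theta/2}} P_{<= N}: symbols multiply under composition. *)
Definition schrodinger_cutoff (theta N t : R) f : R -> R[i] :=
  fourier_multiplier
    (fun xi => schrodinger_symbol theta t xi * cutoff_symbol N xi) f.

(* sum_j lambda_j |e^{it(-Delta)^{theta/2}} P_{<= N} f_j|^2 (x). The series
   converges absolutely for orthonormal f and bounded lambda, since
   sum_j |P_{<= N} f_j|^2 <= 2 N + 1 by Bessel's inequality. *)
Definition density (theta N : R) (J : set nat) (lambda : nat -> R[i])
    (f : nat -> R -> R[i]) (t x : R) : R[i] :=
  cseries (fun j => if `[< J j >]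
    then lambda j * `|schrodinger_cutoff theta N t (f j) x| ^+ 2 else 0).

Local Open Scope ereal_scope.

Definition mixed_norm (p q : \bar R) (I : interval R) (F : R -> R -> R[i]) :
    \bar R :=
  Lnorm (lebesgue_on I) p (fun t =>
    Lnorm (lebesgue_on torus) q (fun x => (Normc.normc (F t x))%:E)).

Definition ell_norm (alpha : R) (J : set nat) (lambda : nat -> R[i]) :
    \bar R :=
  (\esum_(j in J) ((Normc.normc (lambda j)) `^ alpha)%:E) `^ alpha^-1.

Definition alpha_max (q : \bar R) : R :=
  if q is r%:E then (2 * r / (r + 1))%R else 2%R.

End torus.

(* Main.v *)
Require Import Defs.
From HB Require Import structures.
From mathcomp Require Import all_boot all_order all_algebra.
From mathcomp Require Import all_classical all_reals all_analysis.
From mathcomp Require Import measurable_realfun ess_sup_inf ring lra zify.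

(* The case q = oo, alpha = 2 carries all the difficulty: L^theta_t L^oo_x is
   controlled with constant N^((theta-1)/theta).  Cut the time interval into
   blocks of length tau = c N^(1-theta) and each block into about N cells.  Within
   a block the kernel sum_{|xi| <= N} e(t |xi|^theta + x xi) is O(|t|^(-1/theta)):
   the frequencies below |t|^(-1/theta) are bounded trivially, the others by van
   der Corput's second derivative test.  Choosing one point per cell, the estimate
   becomes a finite-dimensional duality argument (Bessel's inequality against the
   Hilbert-Schmidt norm of the dual operator) together with a discrete
   Hardy-Littlewood-Sobolev inequality with kernel |k - l|^(-2/theta), so neither
   measurable selection of the points nor Schatten classes are needed.  Summing
   the O(N^(theta-1)) blocks gives the endpoint.  The other endpoint,
   (p, q, alpha) = (oo, 1, 1), is trivial, and since the densities depend on
   |lambda_j| through a nonnegative kernel, all intermediate cases follow from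
   the pointwise Hoelder inequality
   sum_j |lambda_j| k_j <= (sum_j mu_j k_j)^(1/q) (sum_j nu_j k_j)^(1-1/q)
   with mu_j = |lambda_j|^alpha, nu_j = |lambda_j|^(alpha/2), alpha = 2q/(q+1). *)

Set Implicit Arguments.
Unset Strict Implicit.
Unset Printing Implicit Defensive.
Import Order.TTheory GRing.Theory Num.Theory.
Import numFieldNormedType.Exports.

Local Open Scope classical_set_scope.
Local Open Scope ring_scope.

(** The block length N^(1-theta) is dictated by the largest group speed, of order N^(theta-1).
    During such a time the phase increments over 1 <= xi <= N spread by less than 1, so a single
    resonance modulo 2 pi can occur and the kernel decays as it would on the line. Over longer times
    waves wrap around the circle and this decay is lost, hence the separate treatment of blocks. The
    cell length, of order N^(-theta), is the time at which |t|^(-1/theta) reaches the trivial size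
    N; cells at distance d thus see a kernel of size N d^(-1/theta). The Hilbert-Schmidt norm
    squares it, which gives the exponent 2/theta: this is the Hardy-Littlewood-Sobolev exponent for
    two sequences in l^(theta'), where 1/theta' = 1 - 1/theta, and theta > 2 makes it less than 1.
    Numerically, a block has cell suprema v_k with sum of v_k^theta at most of order N^theta, so it
    contributes O(1) to the time integral. For finite p the same sum serves every pair (p, q),
    because 1 - 1/q = theta/p turns the p-th power of v_k^(1-1/q) into v_k^theta. *)

Section complex_modulus.
Context {R : realType}.
Implicit Types (z w : R[i]) (s t : R).
Local Notation normc := (@Normc.normc R).

Lemma normc_ge0 z : 0 <= normc z.
Proof. by case: z => a b; exact: sqrtr_ge0. Qed.

Lemma ler_normcD z w : normc (z + w) <= normc z + normc w.
Proof. by rewrite -lecR rmorphD; exact: (ler_normD z w). Qed.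

Lemma normcN z : normc (- z) = normc z.
Proof. by case: z => a b /=; rewrite !sqrrN. Qed.

Lemma ler_normcB z w : normc (z - w) <= normc z + normc w.
Proof. by rewrite -(normcN w); exact: ler_normcD. Qed.

Lemma ler_normc_sum (I : Type) (r : seq I) (P : pred I) (F : I -> R[i]) :
  normc (\sum_(i <- r | P i) F i) <= \sum_(i <- r | P i) normc (F i).
Proof.
elim/big_rec2: _ => [|i x y _ h]; first by rewrite Normc.normc0.
exact: le_trans (ler_normcD _ _) (lerD _ h).
Qed.

Lemma sqr_normc z : normc z ^+ 2 = complex.Re z ^+ 2 + complex.Im z ^+ 2.
Proof. by case: z => a b /=; rewrite sqr_sqrtr// addr_ge0// sqr_ge0. Qed.

Lemma sqr_normc_conj z : (normc z ^+ 2)%:C%C = z * (z^*)%C.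
Proof.
rewrite sqr_normc; case: z => a b /=; apply/eqP; rewrite eq_complex /=.
by apply/andP; split; apply/eqP; ring.
Qed.

Lemma normc_conj z : normc (z^*)%C = normc z.
Proof. by case: z => a b /=; rewrite sqrrN. Qed.

Lemma normc_real s : 0 <= s -> normc s%:C%C = s.
Proof. by move=> s0 /=; rewrite expr0n/= addr0 sqrtr_sqr ger0_norm. Qed.

Lemma cexpD s t : cexp (s + t) = cexp s * cexp t.
Proof.
rewrite /cexp cosD sinD; apply/eqP; rewrite eq_complex /=.
by apply/andP; split; apply/eqP; ring.
Qed.

Lemma cexp0 : cexp (0 : R) = 1.
Proof. by rewrite /cexp cos0 sin0. Qed.

Lemma cexpN s : cexp (- s) = ((cexp s)^*)%C.
Proof. by rewrite /cexp cosN sinN. Qed.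

Lemma normc_cexp s : normc (cexp s) = 1.
Proof. by rewrite /= cos2Dsin2 sqrtr1. Qed.

Lemma cexp2pi (n : nat) : cexp (2 * pi * n%:R : R) = 1.
Proof.
rewrite /cexp; have := periodicn (@cosD2pi R) n 0; have := periodicn (@sinD2pi R) n 0.
rewrite !add0r cos0 sin0.
by rewrite -[(pi *+ 2) *+ n]mulr_natr -[pi *+ 2]mulr_natl => -> ->.
Qed.

Lemma cexp2piz (k : int) : cexp (2 * pi * k%:~R : R) = 1.
Proof.
case: k => n; first exact: cexp2pi.
by rewrite NegzE mulrNz mulrN cexpN [X in X^*%C](cexp2pi n.+1) rmorph1.
Qed.

Lemma sqr_normc_1Bcexp s : normc (1 - cexp s) ^+ 2 = 2 * (1 - cos s).
Proof.
rewrite sqr_normc /= sub0r sqrrN; have := cos2Dsin2 s; nra.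
Qed.

End complex_modulus.

(** * Exponential sums *)

Section exponential_sums.
Context {R : realType}.
Local Notation normc := (@Normc.normc R).

Lemma sin_ge_cos1 (x : R) : 0 <= x <= 1 -> x * cos 1 <= sin x.
Proof.
move=> /andP[x0 x1]; have [->|xN0] := eqVneq x 0; first by rewrite mul0r sin0.
have xgt0 : 0 < x by rewrite lt0r xN0.
have [|c /[!in_itv]/= /andP[c0 cx] E] := @MVT R sin cos 0 x xgt0 (fun y _ => is_derive_sin y).
  by apply: continuous_subspaceT => y; exact: continuous_sin.
move: E; rewrite sin0 !subr0 => ->; rewrite mulrC ler_wpM2r//.
have p2 := @pi_ge2 R.
by apply: ltW; rewrite ltr_cos ?in_itv/=; lra.
Qed.

Lemma ler_norm_sin (x : R) : 0 <= x -> `|sin x| <= x.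
Proof.
move=> x0; have [->|xN0] := eqVneq x 0; first by rewrite sin0 normr0.
have xgt0 : 0 < x by rewrite lt0r xN0.
have [|c _ E] := @MVT R sin cos 0 x xgt0 (fun y _ => is_derive_sin y).
  by apply: continuous_subspaceT => y; exact: continuous_sin.
move: E; rewrite sin0 !subr0 => ->.
by rewrite normrM (ger0_norm x0) ler_piMl// cos_max.
Qed.

Lemma chord_upper_bound (x : R) : 0 <= x -> normc (1 - cexp x) <= x.
Proof.
move=> x0; rewrite -(@ler_pXn2r R 2) ?nnegrE ?normc_ge0// sqr_normc_1Bcexp.
have -> : 2 * (1 - cos x) = 4 * sin (x / 2) ^+ 2.
  have := cos_mulr2n (x / 2); have := cos2Dsin2 (x / 2).
  have -> : x / 2 *+ 2 = x by rewrite mulr2n -splitr.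
  by move=> A ->; lra.
have x20 : 0 <= x / 2 by lra.
have : `|sin (x / 2)| ^+ 2 <= (x / 2) ^+ 2 by rewrite ler_pXn2r ?nnegrE// ler_norm_sin.
by rewrite real_normK ?num_real// exprMn; lra.
Qed.

(** The range must pass pi by 1, since later increments are only known to exceed the first one by at
    most 1; it stays away from the next zero 2 pi. Up to 2 the half-angle formula applies. Beyond 2
    the cosine is nonpositive, so the squared chord is at least 2, while x/5 <= 1 because pi < 4. *)
Lemma chord_lower_bound :
  exists2 c : R, 0 < c & forall x, 0 <= x <= pi + 1 -> c * x <= normc (1 - cexp x).
Proof.
have p2 := @pi_ge2 R; have pl := @pihalf_lt2 R.
have c1 := @cos1_gt0 R.
pose c := Num.min (cos 1) (5^-1 : R).
have c0 : 0 < c by rewrite lt_min c1/= invr_gt0.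
exists c => // x /andP[x0 xpi].
rewrite -(@ler_pXn2r R 2)// ?nnegrE ?mulr_ge0 ?normc_ge0 ?(ltW c0)//.
rewrite sqr_normc_1Bcexp exprMn.
have [x2|x2] := leP x 2.
  have -> : 2 * (1 - cos x) = 4 * sin (x / 2) ^+ 2.
    have := cos_mulr2n (x / 2); have := cos2Dsin2 (x / 2).
    have -> : x / 2 *+ 2 = x by rewrite mulr2n -splitr.
    by move=> A ->; lra.
  have := @sin_ge_cos1 (x / 2) ltac:(lra).
  set s := sin _ => H.
  have h1 : (x / 2 * cos 1) ^+ 2 <= s ^+ 2.
    by rewrite ler_pXn2r// nnegrE ?mulr_ge0//; nra.
  have h2 : c ^+ 2 <= cos 1 ^+ 2.
    by rewrite ler_pXn2r ?nnegrE ?(ltW c0) ?(ltW c1)// /c ge_min lexx.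
  have x20 : 0 <= x ^+ 2 by exact: sqr_ge0.
  have : c ^+ 2 * x ^+ 2 <= cos 1 ^+ 2 * x ^+ 2 by rewrite ler_wpM2r.
  rewrite !exprMn in h1; lra.
have h2 : c ^+ 2 <= 5^-1 ^+ 2.
  by rewrite ler_pXn2r ?nnegrE ?(ltW c0) ?invr_ge0// /c ge_min lexx orbT.
have cx : cos x <= 0.
  have [xp|xp] := leP x pi.
    by apply: le_trans (ltW (@cos2_lt0 R)); rewrite ltW// ltr_cos ?in_itv/=; lra.
  have -> : cos x = - cos (x - pi) by rewrite -[in LHS](subrK pi x) cosDpi.
  rewrite oppr_le0; apply: le_trans (ltW c1) _.
  have [->//|xn] := eqVneq (x - pi) 1.
  rewrite ltW// ltr_cos ?in_itv/=; [|lra|lra].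
  by rewrite lt_neqAle xn; lra.
have x5 : x ^+ 2 <= 5 ^+ 2 by rewrite ler_pXn2r ?nnegrE//; lra.
have := @ler_pM R (c ^+ 2) (5^-1 ^+ 2) (x ^+ 2) (5 ^+ 2) (sqr_ge0 _) (sqr_ge0 _) h2 x5.
by lra.
Qed.

(* With g_n = phi_(n+1) - phi_n and q_n = 1/(1 - e(g_n)) one has
   z_n = z_n q_n - z_(n+1) q_n; summing by parts leaves the variation of q, which
   the chord bound compares with that of 1/g and hence telescopes. *)
Lemma kusmin_landau_increasing : exists2 C : R, 0 < C &
  forall (phi : nat -> R) (m : nat) (d : R), 0 < d ->
    (forall n, (n < m)%N -> d <= phi n.+1 - phi n <= pi + 1) ->
    (forall n, (n.+1 < m)%N -> phi n.+1 - phi n <= phi n.+2 - phi n.+1) ->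
  normc (\sum_(n < m.+1) cexp (phi n)) <= 1 + C / d.
Proof.
have [c c0 chord] := chord_lower_bound.
exists (2 / c + c ^- 2); first by rewrite addr_gt0 ?divr_gt0 ?invr_gt0 ?exprn_gt0.
move=> phi m d d0 gb gm.
pose g n := phi n.+1 - phi n.
pose z n := cexp (phi n).
pose q n := (1 - cexp (g n))^-1.
have zS n : z n.+1 = z n * cexp (g n) by rewrite /z /g -cexpD addrC subrK.
have chordg n : (n < m)%N -> c * g n <= normc (1 - cexp (g n)).
  by move=> /gb/andP[a b]; apply: chord; rewrite (le_trans (ltW d0) a).
have g0 n : (n < m)%N -> 0 < g n by move=> /gb/andP[a _]; exact: lt_le_trans a.
have nz n : (n < m)%N -> 1 - cexp (g n) != 0.
  move=> nm; apply/eqP => E; have := chordg _ nm; rewrite E Normc.normc0.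
  by rewrite leNgt mulr_gt0// g0.
have nq n : (n < m)%N -> normc (q n) <= (c * g n)^-1.
  move=> nm; rewrite /q Normc.normcV lef_pV2 ?posrE ?mulr_gt0 ?g0//; first exact: chordg.
  by apply: lt_le_trans (chordg _ nm); rewrite mulr_gt0// g0.
have zq n : (n < m)%N -> z n = z n * q n - z n.+1 * q n.
  by move=> nm; rewrite zS -mulrA -mulrBr -[X in X - _]mul1r -mulrBl mulfV ?mulr1// nz.
have dq n : (n.+1 < m)%N -> normc (q n.+1 - q n) <= c ^- 2 * ((g n)^-1 - (g n.+1)^-1).
  move=> nm; have nm' := ltnW nm.
  have gn := g0 _ nm'; have gn1 := g0 _ nm.
  have -> : q n.+1 - q n = (cexp (g n.+1) - cexp (g n)) * q n * q n.+1.
    rewrite /q; move: (nz _ nm) (nz _ nm'); set a := cexp _; set b := cexp _ => u v.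
    by field; rewrite u v.
  rewrite !Normc.normcM.
  have h : normc (cexp (g n.+1) - cexp (g n)) <= g n.+1 - g n.
    have -> : cexp (g n.+1) - cexp (g n) = - (cexp (g n) * (1 - cexp (g n.+1 - g n))).
      by rewrite mulrBr mulr1 -cexpD [g n + _]addrC subrK opprB.
    rewrite normcN Normc.normcM normc_cexp mul1r chord_upper_bound// subr_ge0.
    exact: gm.
  apply: (@le_trans _ _ ((g n.+1 - g n) * (c * g n)^-1 * (c * g n.+1)^-1)).
    by rewrite !ler_pM ?mulr_ge0 ?normc_ge0 ?nq.
  by rewrite le_eqVlt; apply/orP; left; apply/eqP; field; rewrite !gt_eqF.
case: m gb gm chordg g0 nz nq zq dq => [|m] gb gm chordg g0 nz nq zq dq.
  by rewrite big_ord1 normc_cexp lerDl divr_ge0// ltW// addr_gt0 ?divr_gt0 ?invr_gt0 ?exprn_gt0.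
(* The last term has no increment attached to it; it is paid for by the [1] of the bound. *)
rewrite big_ord_recr /=.
have step k : (k <= m)%N -> normc (\sum_(n < k.+1) z n - (z 0%N * q 0%N - z k.+1 * q k))
    <= c ^- 2 * ((g 0%N)^-1 - (g k)^-1).
  elim: k => [_|k IH km].
    by rewrite big_ord1 -zq// subrr Normc.normc0 subrr mulr0.
  rewrite big_ord_recr /= [z k.+1]zq//.
  set A := \sum_(_ < _) _ in IH *.
  have -> : A + (z k.+1 * q k.+1 - z k.+2 * q k.+1) - (z 0%N * q 0%N - z k.+2 * q k.+1)
     = (A - (z 0%N * q 0%N - z k.+1 * q k)) + z k.+1 * (q k.+1 - q k) by ring.
  apply: le_trans (ler_normcD _ _) _; rewrite Normc.normcM /z normc_cexp mul1r.
  by have := lerD (IH (ltnW km)) (dq _ km); lra.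
have qd n : (n <= m)%N -> (g n)^-1 <= d^-1.
  by move=> nm; rewrite lef_pV2 ?posrE ?g0//; case/andP: (gb _ nm).
have qd' n : (n <= m)%N -> normc (q n) <= (c * d)^-1.
  move=> nm; apply: le_trans (nq _ nm) _.
  by rewrite !invfM ler_wpM2l ?invr_ge0 ?(ltW c0)//; exact: qd.
have := step _ (leqnn m); set A := \sum_(_ < _) _ => stepm.
rewrite -/(z m.+1) addrC.
apply: le_trans (ler_normcD _ _) _; rewrite {1}/z normc_cexp lerD2l.
rewrite -(subrK (z 0%N * q 0%N - z m.+1 * q m) A).
apply: le_trans (ler_normcD _ _) _.
have b1 : normc (z 0%N * q 0%N - z m.+1 * q m) <= (c * d)^-1 + (c * d)^-1.
  apply: le_trans (ler_normcB _ _) _.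
  by rewrite !Normc.normcM /z !normc_cexp !mul1r lerD ?qd'.
have b2 : c ^- 2 * ((g 0%N)^-1 - (g m)^-1) <= c ^- 2 * d^-1.
  rewrite ler_wpM2l ?invr_ge0 ?exprn_ge0 ?(ltW c0)// lerBlDr (le_trans (qd _ _))// lerDl.
  by rewrite invr_ge0 ltW// g0.
apply: le_trans (lerD stepm b1) _; apply: le_trans (lerD b2 (lexx _)) _.
by rewrite le_eqVlt; apply/orP; left; apply/eqP; field; rewrite !gt_eqF.
Qed.

End exponential_sums.

(** * Van der Corput's second derivative test for sums *)

Section van_der_corput.
Context {R : realType}.
Local Notation normc := (@Normc.normc R).

(** Reading the sum backwards changes the sign of the increments and keeps them monotone in the same
    direction, so the increasing case applies. *)
Lemma kusmin_landau_decreasing : exists2 C : R, 0 < C &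
  forall (phi : nat -> R) (m : nat) (d : R), 0 < d ->
    (forall n, (n < m)%N -> d <= phi n - phi n.+1 <= pi + 1) ->
    (forall n, (n.+1 < m)%N -> phi n.+1 - phi n <= phi n.+2 - phi n.+1) ->
  normc (\sum_(n < m.+1) cexp (phi n)) <= 1 + C / d.
Proof.
have [C C0 KL] := @kusmin_landau_increasing R.
exists C => // phi m d d0 gb gm.
rewrite (reindex_inj rev_ord_inj)/=.
pose psi n := phi (m - n)%N.
rewrite (eq_bigr (fun n : 'I_m.+1 => cexp (psi n)))//.
have Sm n : (n < m)%N -> (m - n)%N = (m - n.+1).+1 by move=> nm; rewrite subnSK.
apply: KL => // n nm; rewrite /psi.
  by rewrite (Sm _ nm); apply: gb; rewrite ltn_subrL/= (leq_trans _ nm).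
have nm' := ltnW nm.
rewrite (Sm _ nm') (Sm _ nm).
have h : ((m - n.+2).+1 < m)%N by rewrite -Sm// ltn_subrL/= (leq_trans _ nm).
by have := gm _ h; lra.
Qed.

(** The increments grow by at least d^2 per step. Those below -d and those above d are handled by
    the two Kusmin-Landau bounds, at cost O(1/d) each. The ones in between rise by at most 2d in
    total, so there are at most 1 + 2/d of them and the trivial bound suffices. The threshold d
    balances the three costs. *)
Lemma van_der_corput_near0 : exists2 C : R, 0 < C &
  forall (phi : nat -> R) (m : nat) (d : R), 0 < d ->
    (forall n, (n < m)%N -> `|phi n.+1 - phi n| <= pi + 1) ->
    (forall n, (n.+1 < m)%N -> phi n.+1 - phi n + d ^+ 2 <= phi n.+2 - phi n.+1) ->
  normc (\sum_(n < m.+1) cexp (phi n)) <= C * (1 + d^-1).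
Proof.
have [C1 C10 KL1] := @kusmin_landau_increasing R.
have [C2 C20 KL2] := kusmin_landau_decreasing.
exists (C1 + C2 + 3); first by rewrite !addr_gt0.
move=> phi m d d0 gb gd.
pose g n := phi n.+1 - phi n.
have d20 : 0 < d ^+ 2 by rewrite exprn_gt0.
have gk k n : (n + k < m)%N -> g n + d ^+ 2 *+ k <= g (n + k)%N.
  elim: k => [|k IH]; first by rewrite addn0 mulr0n addr0.
  rewrite addnS => nm; have := IH (ltnW nm); have := gd _ nm.
  by rewrite -/(g _) -/(g _) mulrSr; lra.
have gmono n n' : (n <= n')%N -> (n' < m)%N -> g n <= g n'.
  move=> nn nm; have := @gk (n' - n)%N n; rewrite subnKC// => /(_ nm).
  by apply: le_trans; rewrite lerDl mulrn_wge0// ltW.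
have ginc n : (n.+1 < m)%N -> phi n.+1 - phi n <= phi n.+2 - phi n.+1.
  by move=> nm; apply: gmono.
(* The alternative [n == m] makes a first index exist even when the increments never reach [e]. *)
pose P e n := (n == m) || (e <= g n).
have exP e : exists n, P e n by exists m; rewrite /P eqxx.
have split e : {p | (p <= m)%N & (forall n, (n < p)%N -> g n < e) /\
    (forall n, (p <= n)%N -> (n < m)%N -> e <= g n)}.
  exists (ex_minn (exP e)); case: ex_minnP => p Pp pmin.
    by apply: pmin; rewrite /P eqxx.
  split=> n.
    move=> np; rewrite ltNge; apply: contraTN np => egn; rewrite -leqNgt.
    by apply: pmin; rewrite /P egn orbT.
  move=> pn nm; case/orP: Pp => [/eqP pm|egp]; first by move: nm; rewrite ltnNge -pm pn.
  exact: le_trans egp (gmono _ _ pn nm).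
have [p pm [p1 p2]] := split (- d).
have [r rm [r1 r2]] := split d.
have pr : (p <= r)%N.
  rewrite leqNgt; apply/negP => rp.
  by have := p1 _ rp; have := r2 _ (leqnn _) (leq_trans rp pm); lra.
rewrite -(big_mkord xpredT (fun n => cexp (phi n))).
rewrite (@big_cat_nat _ _ _ p)//=; last exact: leq_trans pm _.
rewrite [X in _ + X](@big_cat_nat _ _ _ r)//=; last exact: leq_trans rm _.
have A1 : normc (\sum_(0 <= n < p) cexp (phi n)) <= 1 + C2 / d.
  rewrite big_mkord; case: p pm p1 p2 pr => [|p] pm p1 p2 pr.
    by rewrite big_ord0 Normc.normc0 addr_ge0// divr_ge0// ltW.
  apply: KL2 => // n np.
    have := p1 _ (ltnW np); rewrite /g => h.
    by have := gb _ (leq_trans np (ltnW pm)); rewrite ler_norml; lra.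
  by apply: ginc; apply: leq_trans np (ltnW pm).
have A3 : normc (\sum_(r <= n < m.+1) cexp (phi n)) <= 1 + C1 / d.
  rewrite -{1}[r]add0n big_addn big_mkord subSn//.
  apply: (KL1 (fun n => phi (n + r)%N)) => // n np; rewrite !addSn.
    have nr : (n + r < m)%N by move: np; rewrite ltn_subRL addnC.
    have := r2 _ (leq_addl n r) nr; rewrite /g => h.
    by have := gb _ nr; rewrite ler_norml; lra.
  by apply: ginc; move: np; rewrite ltn_subRL addnC addSn.
have A2 : normc (\sum_(p <= n < r) cexp (phi n)) <= 1 + 2 / d.
  apply: le_trans (ler_normc_sum _ _ _) _.
  rewrite (eq_bigr (fun=> 1)); last by move=> i _; rewrite normc_cexp.
  rewrite big_const_nat iter_addr_0.
  have [rp|rp] := leqP r p.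
    have -> : (r - p = 0)%N by apply/eqP; rewrite subn_eq0.
    by rewrite mulr0n addr_ge0// divr_ge0// ltW.
  have E : (r - p)%N = (r.-1 - p).+1.
    by rewrite -subSn ?(ltn_predK rp)//; rewrite -ltnS (ltn_predK rp).
  rewrite E mulrSr addrC lerD2l.
  have r1m : (r.-1 < m)%N by rewrite (ltn_predK rp).
  have pr1 : (p <= r.-1)%N by rewrite -ltnS (ltn_predK rp).
  have := @gk (r.-1 - p)%N p; rewrite subnKC// => /(_ r1m).
  have := p2 _ (leqnn _) (leq_ltn_trans pr1 r1m).
  have := r1 r.-1; rewrite (ltn_predK rp) leqnn => /(_ isT).
  set k := (r.-1 - p)%N => u v w.
  rewrite ler_pdivlMr// -(ler_pM2r d0) -mulrA -expr2 mulr_natl.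
  by lra.
apply: le_trans (ler_normcD _ _) _.
apply: le_trans (lerD A1 (le_trans (ler_normcD _ _) (lerD A2 A3))) _.
have dV : 0 < d^-1 by rewrite invr_gt0.
by nra.
Qed.

(* Phases only matter modulo 2 pi n, so the first increment may be brought into
   [-pi, pi]; all the others then stay in [-pi, pi + 1]. *)
Lemma van_der_corput : exists2 C : R, 0 < C &
  forall (phi : nat -> R) (m : nat) (d : R), 0 < d ->
    (forall n, (n < m)%N -> phi n.+1 - phi n <= phi 1%N - phi 0%N + 1) ->
    (forall n, (n.+1 < m)%N -> phi n.+1 - phi n + d ^+ 2 <= phi n.+2 - phi n.+1) ->
  normc (\sum_(n < m.+1) cexp (phi n)) <= C * (1 + d^-1).
Proof.
have [C C0 V] := van_der_corput_near0; exists C => // phi m d d0 gb gd.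
have pi0 := @pi_gt0 R.
have pi20 : 0 < 2 * pi :> R by rewrite mulr_gt0.
pose k : int := Num.floor ((phi 1%N - phi 0%N + pi) / (2 * pi)).
have k1 : k%:~R * (2 * pi) <= phi 1%N - phi 0%N + pi.
  by rewrite -ler_pdivlMr//; exact: (andP (floor_itv _)).1.
have k2 : phi 1%N - phi 0%N + pi < (k%:~R + 1) * (2 * pi).
  have := (andP (floor_itv ((phi 1%N - phi 0%N + pi) / (2 * pi)))).2.
  by rewrite -/k intrD ltr_pdivrMr.
pose psi n := phi n - 2 * pi * (k * n%:Z)%:~R.
rewrite (eq_bigr (fun n : 'I_m.+1 => cexp (psi n))); last first.
  by move=> i _; rewrite /psi cexpD cexpN cexp2piz rmorph1 mulr1.
have psiE n : psi n.+1 - psi n = phi n.+1 - phi n - k%:~R * (2 * pi).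
  by rewrite /psi !intrM -!natz -[n.+1]addn1 !natrD !intrD; ring.
have mono n : (n < m)%N -> phi 1%N - phi 0%N <= phi n.+1 - phi n.
  elim: n => // n IH nm; have := gd _ nm; have := IH (ltnW nm).
  by have := sqr_ge0 d; lra.
apply: V => // n nm.
  rewrite psiE ler_norml; have := gb _ nm; have := mono _ nm; lra.
by rewrite !psiE; have := gd _ nm; lra.
Qed.

End van_der_corput.

(** * Decay of the frequency-localised kernel on short times *)

Section dispersive_estimate.
Context {R : realType}.
Implicit Types (a t u x y N : R).
Local Notation normc := (@Normc.normc R).

Lemma is_derive_powR a x : 0 < x -> is_derive x 1 (@powR R ^~ a) (a * x `^ (a - 1)).
Proof.
move=> x0; have xin : x \in `]0, +oo[ by rewrite in_itv/= andbT.
apply: DeriveDef; first exact: derivable_powR.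
by rewrite -derive1E powR_derive1.
Qed.

Lemma powR_mean_value a x y : 0 < x -> x < y ->
  exists2 z, x < z < y & y `^ a - x `^ a = a * z `^ (a - 1) * (y - x).
Proof.
move=> x0 xy.
have [||z /[!in_itv]/= zxy E] := @MVT R (@powR R ^~ a) (fun z => a * z `^ (a - 1)) x y xy.
- by move=> z /[!in_itv]/= /andP[xz _]; apply: is_derive_powR; exact: lt_trans xz.
- apply: derivable_within_continuous => z /[!in_itv]/= /andP[xz _].
  by apply: derivable_powR; rewrite in_itv/= andbT; exact: lt_le_trans xz.
- by exists z.
Qed.

Lemma powR_forward_difference a u : 1 <= a -> 0 < u ->
  0 <= (u + 1) `^ a - u `^ a <= a * (u + 1) `^ (a - 1).
Proof.
move=> a1 u0; have [|z /andP[uz zu] ->] := @powR_mean_value a u (u + 1) u0.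
  by rewrite ltrDl.
have z0 := lt_trans u0 uz.
rewrite [u + 1]addrC addrK mulr1 mulr_ge0 ?powR_ge0 ?(le_trans ler01)//=.
rewrite ler_wpM2l ?(le_trans ler01)// ge0_ler_powR ?nnegrE ?subr_ge0//; lra.
Qed.

(** Two applications of the mean value theorem give the value a (a-1) w^(a-2) with w > u; moreover a
    (a-1) >= 1, and the power a-2 is increasing since a > 2. *)
Lemma powR_second_difference a u : 2 < a -> 0 < u ->
  u `^ (a - 2) <= (u + 2) `^ a - (u + 1) `^ a - ((u + 1) `^ a - u `^ a).
Proof.
move=> a2 u0.
pose f v := (v + 1) `^ a - v `^ a.
pose df v := a * (v + 1) `^ (a - 1) - a * v `^ (a - 1).
have Df (v : R) : 0 < v -> is_derive v 1 f (df v).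
  move=> v0; apply: is_deriveB; last exact: is_derive_powR.
  have v1 : 0 < v + 1 by rewrite addr_gt0.
  have h1 : is_derive v 1 (fun v : R => v + 1) 1.
    by rewrite -[X in is_derive _ _ _ X]addr0; apply: is_deriveD.
  have := @is_derive1_comp R (@powR R ^~ a) (fun v : R => v + 1) v _ _ (is_derive_powR a v1) h1.
  by rewrite mulr1.
have [|||z /[!in_itv]/= /andP[uz zu] E] := @MVT R f df u (u + 1).
- by rewrite ltrDl.
- by move=> v /[!in_itv]/= /andP[uv _]; apply: Df; exact: lt_trans uv.
- apply: derivable_within_continuous => v /[!in_itv]/= /andP[uv _].
  by have [] := Df v (lt_le_trans u0 uv).
have z0 := lt_trans u0 uz.
have [|w /andP[zw wz] Ew] := @powR_mean_value (a - 1) z (z + 1) z0.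
  by rewrite ltrDl.
have -> : (u + 2) `^ a - (u + 1) `^ a - ((u + 1) `^ a - u `^ a) = f (u + 1) - f u.
  by rewrite /f; congr (_ `^ _ - _ - _); ring.
rewrite E /df -mulrBr Ew.
have -> : u + 1 - u = 1 by ring.
have -> : z + 1 - z = 1 by ring.
have -> : a - 1 - 1 = a - 2 by ring.
rewrite !mulr1 mulrA.
have h : u `^ (a - 2) <= w `^ (a - 2).
  by rewrite ge0_ler_powR ?nnegrE ?subr_ge0 ?(ltW a2) ?(ltW u0) ?(ltW (lt_trans z0 zw))
             ?(ltW (lt_trans uz zw)).
apply: le_trans h _; rewrite ler_peMl ?powR_ge0//.
by clear -a2; nra.
Qed.

(** Put T = t^(-1/theta). Frequencies up to T cost at most T trivially. Above T the second
    differences of the phase are at least T^(-2), so van der Corput with d = 1/T costs O(1 + T), and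
    T >= 1. *)
Lemma half_sum_bound (theta : R) : 2 < theta ->
  exists C c : R, [/\ 0 < C, 0 < c <= 1 & forall (n : nat) N t x,
    1 < N -> n%:R <= N -> 0 < t <= c * N `^ (1 - theta) ->
    normc (\sum_(k < n) cexp (2 * pi * (t * k.+1%:R `^ theta + x * k.+1%:R)))
      <= C * t `^ (- theta^-1)].
Proof.
move=> th2; have [C C0 V] := @van_der_corput R.
have th0 : 0 < theta by lra.
have pi0 := @pi_gt0 R; have pi4 := @pihalf_lt2 R.
(* With this [c], t theta N^(theta-1) <= 1/8, so the phase increments vary by at most 2 pi / 8 < 1,
   which is the slack allowed in [V]. The factor 2 absorbs 1 + T <= 2T. *)
exists (1 + 2 * C), (8 * theta)^-1; split.
- by lra.
- by rewrite invr_gt0 mulr_gt0//= invf_le1 ?mulr_gt0//; lra.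
move=> n N t x N1 nN /andP[t0 tc].
have N0 : 0 < N by lra.
set T := t `^ _.
have t1 : t <= 1.
  apply: le_trans tc _; rewrite -[leRHS]mulr1 ler_pM ?powR_ge0//.
  - by rewrite invr_ge0; lra.
  - by rewrite invf_le1 ?mulr_gt0//; lra.
  - by rewrite -[leRHS](powRr0 N) ler_powR//; lra.
have T1 : 1 <= T.
  by rewrite /T -[leLHS](powRr0 t) ger_powR ?t0// oppr_le0 invr_ge0 ltW.
have T0 : 0 < T by exact: lt_le_trans T1.
have triv m (F : nat -> R) : normc (\sum_(k < m) cexp (F k)) <= m%:R.
  apply: le_trans (ler_normc_sum _ _ _) _.
  rewrite (eq_bigr (fun=> 1)); last by move=> i _; rewrite normc_cexp.
  by rewrite sumr_const card_ord.
pose F k := 2 * pi * (t * k.+1%:R `^ theta + x * k.+1%:R).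
rewrite -/(F _).
pose n0 := Num.truncn T.
have /andP[n0T Tn0] : n0%:R <= T < n0.+1%:R by rewrite truncn_itv// ltW.
have [nn0|n0n] := leqP n n0.
  apply: le_trans (triv n F) _; apply: (@le_trans _ _ T).
    by apply: le_trans n0T; rewrite ler_nat.
  by rewrite ler_peMl// ?(ltW T0)//; lra.
rewrite -(big_mkord xpredT (fun k => cexp (F k))).
rewrite (@big_cat_nat _ _ _ n0)//=; last exact: ltnW.
apply: le_trans (ler_normcD _ _) _.
rewrite big_mkord mulrDl mul1r lerD//; first exact: le_trans (triv _ _) n0T.
rewrite -{1}[n0]add0n big_addn big_mkord.
have -> : (n - n0 = (n - n0).-1.+1)%N by rewrite prednK// subn_gt0.
set m := (n - n0).-1.
have mn : (m + n0 < n)%N by rewrite addnC -ltn_subRL /m prednK// subn_gt0.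
apply: (@le_trans _ _ (C * (1 + T^-1^-1))); last first.
  by rewrite invrK -mulrA mulrCA ler_pM2l//; lra.
have FS k : F k.+1 - F k = 2 * pi * (t * ((k.+1%:R + 1) `^ theta - k.+1%:R `^ theta) + x).
  by rewrite /F -[k.+2]addn1 natrD; ring.
apply: (V (fun k => F (k + n0)%N)); first by rewrite invr_gt0.
  move=> k km; rewrite !addSn add0n !FS.
  have Nk : (k + n0).+1%:R + 1 <= N.
    by apply: le_trans nN; rewrite natr1 ler_nat (leq_ltn_trans _ mn)// -addSn leq_add2r.
  have k0 : 0 < (k + n0).+1%:R :> R by rewrite ltr0n.
  have n00 : 0 < n0.+1%:R :> R by rewrite ltr0n.
  have th1 : 1 <= theta by lra.
  have /andP[_ a1] := powR_forward_difference th1 k0.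
  have /andP[a2 _] := powR_forward_difference th1 n00.
  set A := _ `^ theta - _ `^ theta in a1 *; set B := _ `^ theta - _ `^ theta in a2 *.
  have a3 : A <= theta * N `^ (theta - 1).
    apply: le_trans a1 _; rewrite ler_wpM2l ?(ltW th0)//.
    by rewrite ge0_ler_powR ?nnegrE//; lra.
  have a4 : t * (theta * N `^ (theta - 1)) <= 8^-1.
    have : t * N `^ (theta - 1) <= (8 * theta)^-1.
      rewrite -ler_pdivlMr ?powR_gt0// -powRN; apply: le_trans tc _.
      by rewrite opprB.
    rewrite invfM ler_pdivlMr// => h; lra.
  have a5 : t * A <= 8^-1 by apply: le_trans a4; rewrite ler_pM2l.
  have a6 : 0 <= t * B by rewrite mulr_ge0// ltW.
  have a7 : pi * (t * A) <= pi * 8^-1 by rewrite ler_pM2l.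
  have a8 : 0 <= pi * (t * B) by rewrite mulr_ge0// ltW.
  lra.
move=> k km; rewrite !addSn !FS.
have k0 : 0 < (k + n0).+1%:R :> R by rewrite ltr0n.
have := powR_second_difference th2 k0.
have -> : (k + n0).+2%:R + 1 = (k + n0).+1%:R + 2 :> R by rewrite -[(k + n0).+2]addn1 natrD; ring.
have -> : (k + n0).+2%:R = (k + n0).+1%:R + 1 :> R by rewrite -[(k + n0).+2]addn1 natrD.
set v := (k + n0).+1%:R.
(* Index k stands for the frequency k+1, so dropping the first [n0] indices, [n0] being the integer
   part of T, leaves only frequencies above T. *)
have Tv : T <= v by apply: le_trans (ltW Tn0) _; rewrite ler_nat ltnS leq_addl.
have b1 : T `^ (theta - 2) <= v `^ (theta - 2).
  by rewrite ge0_ler_powR ?nnegrE//; lra.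
(* This identity is what singles out the splitting point T = t^(-1/theta). *)
have b2 : T^-1 ^+ 2 = t * T `^ (theta - 2).
  rewrite /T -powRN opprK -powR_mulrn ?powR_ge0// -!powRrM.
  have tM e : t * t `^ e = t `^ (1 + e).
    by rewrite powRD ?powRr1 ?(ltW t0)// (gt_eqF t0) implybT.
  rewrite tM.
  by congr (_ `^ _); field; rewrite gt_eqF.
rewrite b2 => b3.
have b4 : t * T `^ (theta - 2) <= t * ((v + 2) `^ theta - (v + 1) `^ theta -
    ((v + 1) `^ theta - v `^ theta)).
  by rewrite ler_pM2l// (le_trans b1).
move: b4; set D := _ - _ - _ => b4.
have b5 : 0 <= t * D by apply: le_trans b4; rewrite mulr_ge0 ?powR_ge0// ltW.
have b6 : t * D <= 2 * pi * (t * D) by rewrite ler_peMl//; have := @pi_ge2 R; lra.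
by move: b4 b6; rewrite /D; lra.
Qed.

(** The integers of [-n, n] as a list; [Negz k] is -(k+1), hence the two different lengths. *)
Definition frequencies (n : nat) : seq int :=
  [seq Posz k | k <- iota 0 n.+1] ++ [seq Negz k | k <- iota 0 n].

Lemma sum_frequencies (V : nmodType) (n : nat) (F : int -> V) :
  \sum_(xi <- frequencies n) F xi =
  F 0 + \sum_(k < n) F k.+1%:Z + \sum_(k < n) F (Negz k).
Proof.
have iotaE m (G : nat -> V) : \sum_(k <- iota 0 m) G k = \sum_(k < m) G k.
  by rewrite -(big_mkord xpredT) /index_iota subn0.
by rewrite big_cat !big_map !iotaE big_ord_recl.
Qed.

(** Complex conjugation reverses the sign of t, and x -> -x exchanges positive and negative
    frequencies. The zero frequency contributes 1, which is absorbed since |t| <= 1 gives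
    |t|^(-1/theta) >= 1. *)
Lemma dispersive_estimate (theta : R) : 2 < theta ->
  exists C c : R, [/\ 0 < C, 0 < c <= 1 & forall (n : nat) N t x,
    1 < N -> n%:R <= N -> t != 0 -> `|t| <= c * N `^ (1 - theta) ->
    normc (\sum_(xi <- frequencies n)
        cexp (2 * pi * (t * (`|xi%:~R : R| `^ theta) + x * xi%:~R)))
      <= C * `|t| `^ (- theta^-1)].
Proof.
move=> th2; have [C [c [C0 c01 H]]] := half_sum_bound th2.
exists (1 + 2 * C), c; split=> //; first by lra.
suff pos n N t x : 1 < N -> n%:R <= N -> 0 < t <= c * N `^ (1 - theta) ->
    normc (\sum_(xi <- frequencies n)
        cexp (2 * pi * (t * (`|xi%:~R : R| `^ theta) + x * xi%:~R)))
      <= (1 + 2 * C) * t `^ (- theta^-1).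
  move=> n N t x N1 nN tN0 tc; have [t0|t0] := ltP 0 t.
    by rewrite gtr0_norm//; apply: pos N1 nN _; rewrite t0 -(gtr0_norm t0).
  have {}t0 : t < 0 by rewrite lt_neqAle tN0.
  rewrite -normc_conj rmorph_sum ltr0_norm//.
  rewrite (eq_bigr (fun xi => cexp (2 * pi * (- t * (`|xi%:~R : R| `^ theta) + - x * xi%:~R)))).
    by apply: pos N1 nN _; rewrite oppr_gt0 t0 -(ltr0_norm t0).
  by move=> xi _; rewrite [LHS](esym (cexpN _)); congr cexp; ring.
move=> N1 nN tc; rewrite sum_frequencies.
have t0 : 0 < t by case/andP: tc.
have T1 : 1 <= t `^ (- theta^-1).
  rewrite -[leLHS](powRr0 t) ger_powR ?t0 ?oppr_le0 ?invr_ge0//=; last by lra.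
  case/andP: tc => _ /le_trans; apply.
  have N1' : N `^ (1 - theta) <= 1 by rewrite -[leRHS](powRr0 N) ler_powR//; lra.
  have := powR_ge0 N (1 - theta); nra.
apply: le_trans (ler_normcD _ _) _.
apply: le_trans (lerD (ler_normcD _ _) (lexx _)) _.
have Z : normc (cexp (2 * pi * (t * (`|(0 : int)%:~R : R| `^ theta) + x * 0%:~R))) = 1.
  exact: normc_cexp.
rewrite Z.
have h1 := H n N t x N1 nN tc.
have h2 := H n N t (- x) N1 nN tc.
rewrite -[X in normc X](_ : \sum_(k < n) cexp (2 * pi * (t * k.+1%:R `^ theta + x * k.+1%:R)) = _);
  last by apply: eq_bigr => k _; rewrite -pmulrn ger0_norm.
rewrite -[X in _ + normc X <= _](_ :
    \sum_(k < n) cexp (2 * pi * (t * k.+1%:R `^ theta + - x * k.+1%:R)) = _); last first.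
  by apply: eq_bigr => k _; rewrite NegzE mulrNz -pmulrn normrN ger0_norm// mulrN mulNr.
by move: h1 h2; lra.
Qed.

End dispersive_estimate.

(** * The discrete endpoint estimate *)

Section discrete_hardy_littlewood_sobolev.
Context {R : realType}.
Implicit Types (g theta : R) (d n m k l : nat).

(** This is |k - l|: one of the two truncated differences is zero. *)
Definition index_gap k l : nat := ((k - l) + (l - k))%N.

Lemma index_gapC k l : index_gap k l = index_gap l k.
Proof. exact: addnC. Qed.

Lemma ler_sum_ord n m (f : nat -> R) : (n <= m)%N -> (forall d, 0 <= f d) ->
  \sum_(d < n) f d <= \sum_(d < m) f d.
Proof.
move=> nm f0; rewrite -!(big_mkord xpredT) (@big_cat_nat _ _ _ n 0 m)//= lerDl.
by apply: sumr_ge0.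
Qed.

(** Each distance to k is attained at most once on either side, and every distance that occurs is
    below n. *)
Lemma sum_index_gap_le n k (f : nat -> R) : (forall d, 0 <= f d) -> (k < n)%N ->
  \sum_(l < n) f (index_gap k l) <= 2 * \sum_(d < n) f d.
Proof.
move=> f0 kn; rewrite -(big_mkord xpredT (fun l => f (index_gap k l))).
rewrite (@big_cat_nat _ _ _ k)//=; last exact: ltnW.
rewrite mulr_natl mulr2n lerD//.
  apply: le_trans (ler_sum_ord kn f0).
  rewrite big_nat_rev big_ord_recl/= -(big_mkord xpredT (fun d => f (bump 0 d))) big_nat [X in _ <= _ + X]big_nat.
  rewrite (eq_bigr (fun d => f (bump 0 d))); first by rewrite lerDr.
  by move=> d /andP[_ dk]; congr f; rewrite /index_gap /bump/=; lia.
rewrite -{1}[k]add0n big_addn big_mkord.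
apply: le_trans (ler_sum_ord (leq_subr k n) f0).
rewrite le_eqVlt; apply/orP; left; apply/eqP; apply: eq_bigr => d _.
by congr f; rewrite /index_gap; lia.
Qed.

Lemma sum_below_le n r (f : nat -> R) : (forall d, 0 <= f d) ->
  \sum_(d < n) (d < r)%N%:R * f d <= \sum_(d < r) f d.
Proof.
move=> f0; have h d : 0 <= (d < r)%N%:R * f d by rewrite mulr_ge0.
apply: le_trans (@ler_sum_ord n (r + n)%N _ (leq_addl _ _) h) _.
rewrite -(big_mkord xpredT (fun d => (d < r)%N%:R * f d)) -(big_mkord xpredT f).
rewrite (@big_cat_nat _ _ _ r 0 (r + n))//= ?leq_addr//.
rewrite [X in _ + X]big_nat [X in _ + X]big1 ?addr0; last first.
  by move=> i /andP[ri _]; rewrite ltnNge ri mul0r.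
rewrite big_nat [leRHS]big_nat ler_sum// => i /andP[_ ->].
by rewrite mul1r.
Qed.

Lemma sum_above_le n r (f : nat -> R) : (forall d, 0 <= f d) ->
  \sum_(d < n) (r <= d)%N%:R * f d <= \sum_(r <= d < r + n) f d.
Proof.
move=> f0; have h d : 0 <= (r <= d)%N%:R * f d by rewrite mulr_ge0.
apply: le_trans (@ler_sum_ord n (r + n)%N _ (leq_addl _ _) h) _.
rewrite -(big_mkord xpredT (fun d => (r <= d)%N%:R * f d)).
rewrite (@big_cat_nat _ _ _ r 0 (r + n))//= ?leq_addr//.
rewrite [X in X + _]big_nat [X in X + _]big1 ?add0r; last first.
  by move=> i /andP[_ ri]; rewrite leqNgt ri mul0r.
rewrite big_nat [leRHS]big_nat ler_sum// => i /andP[-> _].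
by rewrite mul1r.
Qed.

(** The kernel d^(-g), regularised so that the diagonal has weight 1. *)
Definition decay g d : R := (maxn 1 d)%:R `^ (- g).

Lemma decay_ge0 g d : 0 <= decay g d.
Proof. exact: powR_ge0. Qed.

(** Comparison with the integral of x^(-g), done one step at a time by the mean value theorem; the
    [2] pays for d = 0 and d = 1. *)
Lemma sum_decay_le g m : 0 < g < 1 ->
  \sum_(d < m.+1) decay g d <= 2 + m%:R `^ (1 - g) / (1 - g).
Proof.
move=> /andP[g0 g1]; have g1' : 0 < 1 - g by rewrite subr_gt0.
elim: m => [|m IH].
  rewrite big_ord1 /decay maxn0 powR1 ler_wpDr//; last by rewrite ler1n.
  by rewrite divr_ge0 ?powR_ge0// ltW.
rewrite big_ord_recr /= /decay maxnE subnKC//.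
case: m IH => [|m] IH.
  rewrite big_ord1 /decay maxn0 !powR1.
  have : 0 <= 1 / (1 - g) by rewrite divr_ge0// ltW.
  by move: (1 / _) => y y0; lra.
have m0 : 0 < m.+1%:R :> R by rewrite ltr0n.
have mm : m.+1%:R < m.+2%:R :> R by rewrite ltr_nat.
have [z /andP[mz zm] E] := powR_mean_value (1 - g) m0 mm.
have z0 : 0 < z by exact: lt_trans mz.
apply: le_trans (lerD IH (lexx _)) _; rewrite -addrA lerD2l -lerBrDl -mulrBl E.
have -> : m.+2%:R - m.+1%:R = 1 :> R by rewrite -[m.+2]addn1 natrD addrAC subrr add0r.
rewrite mulr1 mulrAC divff ?gt_eqF// mul1r.
have -> : 1 - g - 1 = - g by ring.
rewrite !powRN lef_pV2 ?posrE ?powR_gt0 ?ltr0n//.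
by rewrite ge0_ler_powR ?nnegrE ?(ltW g0) ?(ltW z0) ?(ltW zm).
Qed.

(** Since 2k >= k+1, 1/k^2 is at most 2/k - 2/(k+1), which telescopes; the induction carries the end
    term of the telescoping sum. *)
Lemma sum_inv_sqr_le r n : (0 < r)%N ->
  \sum_(r <= d < r + n) (d%:R : R) ^- 2 <= 2 / r%:R.
Proof.
move=> r0; apply: (@le_trans _ _ (2 / r%:R - 2 / (r + n)%:R)); last by rewrite lerBlDr lerDl divr_ge0.
elim: n => [|n IH]; first by rewrite addn0 big_geq// subrr.
rewrite addnS big_nat_recr ?leq_addr//=.
apply: le_trans (lerD IH (lexx _)) _.
have : (0 < r + n)%N by rewrite addn_gt0 r0.
move: (r + n)%N => k k0; rewrite -addrA lerD2l -[k.+1]addn1 natrD.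
have k1 : 1 <= k%:R :> R by rewrite ler1n.
rewrite -subr_ge0.
have -> : - (2 / (k%:R + 1)) - (- (2 / k%:R) + k%:R ^- 2) =
   (k%:R - 1) / (k%:R ^+ 2 * (k%:R + 1)) :> R.
  by field; rewrite ?gt_eqF//; lra.
by rewrite divr_ge0 ?subr_ge0// mulr_ge0 ?exprn_ge0//; lra.
Qed.

(* For fixed k only the l with u_l <= u_k need be considered.  Split at
   r ~ u_k^(-theta): for gaps below r use u_l <= u_k, beyond r use
   u_l^(theta-1) w <= u_k u_l^theta + u_k^(1-theta) w^theta. *)
Lemma discrete_hardy_littlewood_sobolev theta : 2 < theta ->
  exists2 C : R, 0 < C & forall n (u : nat -> R), (forall k, 0 <= u k) ->
    \sum_(k < n) u k `^ theta <= 1 ->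
    \sum_(k < n) \sum_(l < n)
      u k `^ (theta - 1) * u l `^ (theta - 1) * decay (2 / theta) (index_gap k l) <= C.
Proof.
move=> th2; have th0 : 0 < theta by lra.
set g := 2 / theta.
have g01 : 0 < g < 1 by rewrite divr_gt0//= ltr_pdivrMr// mul1r.
have [g0 g1] := andP g01.
pose C0 := 2 + (1 - g)^-1.
have C00 : 0 < C0 by rewrite addr_gt0// invr_gt0 subr_gt0.
(* The outer 2 comes from symmetry in k and l. Inside, [2 * C0] pays for gaps below r, 1 for the
   mass of u^theta, and 8 for the tail 4/r, as 1/r <= 2 u_k^theta. *)
exists (2 * (2 * C0 + 1 + 8)); first by rewrite mulr_gt0// !addr_gt0// mulr_gt0.
move=> n u u0 su.
pose a k l := u k `^ (theta - 1) * u l `^ (theta - 1) * decay g (index_gap k l).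
have a0 k l : 0 <= a k l by rewrite !mulr_ge0 ?powR_ge0.
have aC k l : a k l = a l k by rewrite /a index_gapC [X in X * _]mulrC.
have half k : (k < n)%N ->
    \sum_(l < n) (u l <= u k)%R%:R * a k l <= (2 * C0 + 1 + 8) * u k `^ theta.
  move=> kn; have [uk0|uk0] := eqVneq (u k) 0.
    rewrite big1 ?mulr_ge0 ?powR_ge0 ?addr_ge0 ?mulr_ge0 ?(ltW C00)//.
    by move=> l _; rewrite /a uk0 powR0 ?mul0r ?mulr0//; rewrite gt_eqF//; lra.
  have uk : 0 < u k by rewrite lt0r uk0 u0.
  have ukth : u k `^ theta <= 1.
    apply: le_trans su; rewrite (bigD1 (Ordinal kn))//= lerDl.
    by apply: sumr_ge0 => *; exact: powR_ge0.
  pose U := u k `^ (- theta).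
  have U1 : 1 <= U by rewrite /U powRN invf_ge1 ?powR_gt0.
  pose r := Num.truncn U.
  have /andP[rU Ur] : r%:R <= U < r.+1%:R by rewrite truncn_itv// (le_trans ler01).
  have r0 : (0 < r)%N by rewrite truncn_gt0.
  have r0' : 0 < r%:R :> R by rewrite ltr0n.
  pose f1 d := (d < r)%N%:R * decay g d.
  pose f2 d := (r <= d)%N%:R * (d%:R : R) ^- 2.
  have f10 d : 0 <= f1 d by rewrite mulr_ge0// decay_ge0.
  have f20 d : 0 <= f2 d by rewrite mulr_ge0// invr_ge0 exprn_ge0.
  have termwise l : (u l <= u k)%R%:R * (u l `^ (theta - 1) * decay g (index_gap k l)) <=
      u k `^ (theta - 1) * f1 (index_gap k l) + u k * u l `^ theta
      + u k `^ (1 - theta) * f2 (index_gap k l).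
    set d := index_gap k l.
    have t1 : 0 <= u k `^ (theta - 1) * f1 d by rewrite mulr_ge0 ?powR_ge0.
    have t2 : 0 <= u k * u l `^ theta by rewrite mulr_ge0 ?powR_ge0.
    have t3 : 0 <= u k `^ (1 - theta) * f2 d by rewrite mulr_ge0 ?powR_ge0.
    have [ulk|_] := boolP (u l <= u k)%R; last by rewrite mul0r !addr_ge0.
    rewrite mul1r; have [dr|rd] := ltnP d r.
      rewrite -addrA ler_wpDr ?addr_ge0// /f1 dr mul1r ler_wpM2r ?decay_ge0//.
      by rewrite ge0_ler_powR ?nnegrE//; lra.
    have d0 : (0 < d)%N by exact: leq_trans rd.
    have wE : decay g d `^ theta = d%:R ^- 2.
      rewrite /decay maxnE subnKC// -powRrM mulNr /g divfK ?gt_eqF//.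
      by rewrite powRN powR_mulrn.
    (* If w <= u_k u_l, replace w by u_k u_l. Otherwise u_l < w / u_k, and the resulting w^theta =
       d^(-2) is summable. *)
    have [wu|uw] := leP (decay g d) (u k * u l).
      apply: (@le_trans _ _ (u k * u l `^ theta)).
        rewrite -(@mulr_powRB1 _ (u l) theta)// mulrA mulrC ler_wpM2r ?powR_ge0//.
      by rewrite -addrA addrCA lerDl addr_ge0.
    apply: (@le_trans _ _ (u k `^ (1 - theta) * f2 d)); last by rewrite lerDr addr_ge0.
    rewrite /f2 rd mul1r -wE -(@mulr_powRB1 _ (decay g d) theta) ?decay_ge0//.
    rewrite mulrA mulrAC ler_wpM2r ?decay_ge0//.
    have -> : u k `^ (1 - theta) = (u k)^-1 `^ (theta - 1).
      by rewrite -powR_inv1 ?(ltW uk)// -powRrM; congr powR; ring.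
    rewrite -powRM ?invr_ge0 ?(ltW uk) ?decay_ge0//.
    rewrite ge0_ler_powR ?nnegrE ?mulr_ge0 ?invr_ge0 ?decay_ge0 ?(ltW uk)//; first by lra.
    by rewrite ler_pdivlMl// ltW.
  have S1 : \sum_(l < n) f1 (index_gap k l) <= 2 * (C0 * r%:R `^ (1 - g)).
    apply: le_trans (sum_index_gap_le f10 kn) _; rewrite ler_pM2l//.
    apply: le_trans (sum_below_le _ _ (decay_ge0 g)) _.
    apply: le_trans (ler_sum_ord (leqnSn _) (decay_ge0 g)) _.
    apply: le_trans (sum_decay_le _ g01) _.
    rewrite mulrDl [X in _ + X]mulrC lerD2r ler_peMr//.
    apply: (@le_trans _ _ (1 `^ (1 - g))); first by rewrite powR1.
    by rewrite ge0_ler_powR ?nnegrE ?ler1n ?subr_ge0 ?(ltW g1).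
  have S2 : \sum_(l < n) f2 (index_gap k l) <= 2 * (2 / r%:R).
    apply: le_trans (sum_index_gap_le f20 kn) _; rewrite ler_pM2l//.
    apply: le_trans (@sum_above_le _ _ (fun d => d%:R ^- 2) _) _.
      by move=> d; rewrite invr_ge0 exprn_ge0.
    exact: sum_inv_sqr_le.
  have S3 : \sum_(l < n) (u l <= u k)%R%:R * (u l `^ (theta - 1) * decay g (index_gap k l))
      <= (2 * C0 + 1 + 8) * u k.
    apply: le_trans (ler_sum _ (fun (l : 'I_n) _ => termwise l)) _.
    rewrite !big_split/= -!mulr_sumr.
    have p1 : u k `^ (theta - 1) * (\sum_(l < n) f1 (index_gap k l)) <= 2 * C0 * u k.
      apply: (@le_trans _ _ (u k `^ (theta - 1) * (2 * (C0 * u k `^ (2 - theta))))).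
        rewrite ler_wpM2l ?powR_ge0//; apply: le_trans S1 _.
        rewrite ler_pM2l// ler_pM2l//.
        have -> : u k `^ (2 - theta) = U `^ (1 - g).
          rewrite /U -powRrM; congr powR; by rewrite /g; field; rewrite gt_eqF.
        by rewrite ge0_ler_powR ?nnegrE//; [lra|exact: powR_ge0].
      rewrite [X in _ * X]mulrA mulrCA -powRD; last by rewrite uk0 implybT.
      have -> : theta - 1 + (2 - theta) = 1 by ring.
      by rewrite powRr1// ltW.
    have p2 : u k * (\sum_(l < n) u l `^ theta) <= u k by rewrite ler_piMr// ltW.
    have p3 : u k `^ (1 - theta) * (\sum_(l < n) f2 (index_gap k l)) <= 8 * u k.
      apply: (@le_trans _ _ (u k `^ (1 - theta) * (8 * u k `^ theta))).
        rewrite ler_wpM2l ?powR_ge0//; apply: le_trans S2 _.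
        have -> : u k `^ theta = U^-1 by rewrite /U powRN invrK.
        rewrite mulrA ler_pdivrMr// mulrAC ler_pdivlMr ?(lt_le_trans ltr01)//.
        have : r.+1%:R <= 2 * r%:R :> R by rewrite -natrM ler_nat mul2n -addnn -addn1 leq_add2l.
        move: Ur; clear; lra.
      rewrite mulrCA -powRD; last by rewrite uk0 implybT.
      by rewrite subrK powRr1// ltW.
    move: p1 p2 p3; clear; lra.
  rewrite (eq_bigr (fun l : 'I_n => u k `^ (theta - 1) *
    ((u l <= u k)%R%:R * (u l `^ (theta - 1) * decay g (index_gap k l))))); last first.
    by move=> l _; rewrite /a; ring.
  rewrite -mulr_sumr; apply: le_trans (ler_wpM2l (powR_ge0 _ _) S3) _.
  by rewrite mulrCA [X in _ * X]mulrC mulr_powRB1.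
apply: (@le_trans _ _ (\sum_(k < n) \sum_(l < n)
    ((u l <= u k)%R%:R * a k l + (u k <= u l)%R%:R * a k l))).
  apply: ler_sum => k _; apply: ler_sum => l _; rewrite -/(a k l).
  case: (leP (u l) (u k)) => h; first by rewrite mul1r lerDl mulr_ge0.
  by rewrite (ltW h) mul0r add0r mul1r.
under eq_bigr do rewrite big_split/=.
rewrite big_split/= [X in _ + X]exchange_big/=.
rewrite [X in _ + X](eq_bigr (fun k : 'I_n => \sum_(l < n) (u l <= u k)%R%:R * a k l)); last first.
  by move=> k _; apply: eq_bigr => l _; rewrite aC.
rewrite -mulr2n -[leLHS]mulr_natl ler_pM2l//.
apply: le_trans (ler_sum _ (fun (k : 'I_n) _ => half k (ltn_ord k))) _.
by rewrite -mulr_sumr ler_piMr// !addr_ge0// mulr_ge0// ltW.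
Qed.

End discrete_hardy_littlewood_sobolev.

(** * Finite-dimensional duality *)

Section duality.
Context {R : realType} {T : eqType}.
Local Notation normc := (@Normc.normc R).

(** Lagrange's identity: the defect is half a double sum of squares. *)
Lemma cauchy_schwarz_sum (I : Type) (s : seq I) (a b : I -> R) :
  (\sum_(i <- s) a i * b i) ^+ 2 <= (\sum_(i <- s) a i ^+ 2) * (\sum_(i <- s) b i ^+ 2).
Proof.
have : 0 <= \sum_(i <- s) \sum_(j <- s) (a i * b j - a j * b i) ^+ 2.
  by apply: sumr_ge0 => i _; apply: sumr_ge0 => j _; exact: sqr_ge0.
have -> : \sum_(i <- s) \sum_(j <- s) (a i * b j - a j * b i) ^+ 2 =
    \sum_(i <- s) \sum_(j <- s) (a i ^+ 2 * b j ^+ 2)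
    + \sum_(i <- s) \sum_(j <- s) (a j ^+ 2 * b i ^+ 2)
    - 2 * (\sum_(i <- s) \sum_(j <- s) ((a i * b i) * (a j * b j))).
  rewrite mulr_sumr -big_split -sumrB; apply: eq_bigr => i _.
  rewrite mulr_sumr -big_split -sumrB; apply: eq_bigr => j _ /=; ring.
rewrite [X in _ + X - _]exchange_big/= -big_distrlr/= -big_distrlr/= -expr2.
lra.
Qed.

Lemma cauchy_schwarz_normc (I : Type) (s : seq I) (u v : I -> R[i]) :
  normc (\sum_(i <- s) u i * v i) ^+ 2 <=
  (\sum_(i <- s) normc (u i) ^+ 2) * (\sum_(i <- s) normc (v i) ^+ 2).
Proof.
apply: le_trans (cauchy_schwarz_sum _ _ _).
rewrite ler_pXn2r ?nnegrE ?normc_ge0 ?sumr_ge0//.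
  by apply: le_trans (ler_normc_sum _ _ _) _; apply: ler_sum => i _; rewrite Normc.normcM.
by move=> i _; rewrite mulr_ge0 ?normc_ge0.
Qed.

(** The matrix (a_j(x)) is a contraction from l^2(s) to l^2. It is in this form that orthonormality
    enters the discrete argument. The pairing carries no conjugate, which is harmless as [v] is
    arbitrary. *)
Definition bessel (s : seq T) (m : nat) (a : nat -> T -> R[i]) :=
  forall v : T -> R[i], \sum_(j < m) normc (\sum_(x <- s) a j x * v x) ^+ 2
    <= \sum_(x <- s) normc (v x) ^+ 2.

(** Testing with the conjugate of a row of squared norm A gives A^2 <= A. *)
Lemma bessel_norm_le1 (s : seq T) m a : bessel s m a ->
  forall j, (j < m)%N -> \sum_(x <- s) normc (a j x) ^+ 2 <= 1.
Proof.
move=> B j jm; set A := \sum_(x <- s) _.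
have A0 : 0 <= A by apply: sumr_ge0 => x _; exact: sqr_ge0.
have : A ^+ 2 <= A.
  have := B (fun x => ((a j x)^*)%C).
  rewrite [leRHS](eq_bigr (fun x => normc (a j x) ^+ 2)); last by move=> x _; rewrite normc_conj.
  apply: le_trans; rewrite (bigD1 (Ordinal jm))//=.
  have -> : \sum_(x <- s) a j x * ((a j x)^*)%C = A%:C%C.
    by rewrite rmorph_sum/=; apply: eq_bigr => x _; rewrite sqr_normc_conj.
  by rewrite normc_real// lerDl sumr_ge0// => *; exact: sqr_ge0.
rewrite expr2; move: A0; clear; nra.
Qed.

(* With B(x,y) = sum_k h_k E_k(x) conj(E_k(y)), the left-hand side is
   sum_j <a_j, B a_j>^2 and the right-hand side is the squared Hilbert-Schmidt
   norm of B. *)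
Lemma hilbert_schmidt_duality (s : seq T) m (a : nat -> T -> R[i]) n
    (E : nat -> T -> R[i]) (h : nat -> R) : bessel s m a ->
  \sum_(j < m) (\sum_(k < n) h k * normc (\sum_(x <- s) a j x * E k x) ^+ 2) ^+ 2
  <= \sum_(k < n) \sum_(l < n)
       h k * h l * normc (\sum_(x <- s) E k x * ((E l x)^*)%C) ^+ 2.
Proof.
move=> B.
pose b x y : R[i] := \sum_(k < n) (h k)%:C%C * (E k x * ((E k y)^*)%C).
pose c j y := \sum_(x <- s) a j x * b x y.
have XE j : (\sum_(k < n) h k * normc (\sum_(x <- s) a j x * E k x) ^+ 2)%:C%C
    = \sum_(y <- s) ((a j y)^*)%C * c j y.
  transitivity (\sum_(k < n) \sum_(y <- s) \sum_(x <- s)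
      (h k)%:C%C * (a j x * E k x * (((a j y)^*)%C * ((E k y)^*)%C))).
    rewrite rmorph_sum/=; apply: eq_bigr => k _.
    rewrite rmorphM/= sqr_normc_conj rmorph_sum/= big_distrlr exchange_big/= mulr_sumr.
    apply: eq_bigr => y _; rewrite mulr_sumr; apply: eq_bigr => x _.
    by rewrite rmorphM.
  rewrite exchange_big/=; apply: eq_bigr => y _; rewrite exchange_big/=.
  rewrite /c mulr_sumr; apply: eq_bigr => x _.
  by rewrite /b !mulr_sumr; apply: eq_bigr => k _; ring.
apply: (@le_trans _ _ (\sum_(j < m) \sum_(y <- s) normc (c j y) ^+ 2)).
  apply: ler_sum => j _.
  have -> : forall x : R, x ^+ 2 = normc x%:C%C ^+ 2 by move=> x; rewrite sqr_normc/= expr0n/= addr0.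
  rewrite XE; apply: le_trans (cauchy_schwarz_normc _ _ _) _.
  rewrite ler_piMl//; first by apply: sumr_ge0 => *; exact: sqr_ge0.
  under eq_bigr do rewrite normc_conj.
  exact: (bessel_norm_le1 B).
(* With y outermost, the Bessel inequality applies to each column v = b(., y), and the
   Hilbert-Schmidt norm of B remains. *)
rewrite exchange_big/=.
apply: (@le_trans _ _ (\sum_(y <- s) \sum_(x <- s) normc (b x y) ^+ 2)).
  by apply: ler_sum => y _; exact: B.
rewrite -lecR le_eqVlt; apply/orP; left; apply/eqP.
have cE l x y : (((h l)%:C%C * (E l x * ((E l y)^*)%C))^*)%C =
    (h l)%:C%C * (((E l x)^*)%C * E l y).
  case: (E l x) (E l y) => [p q] [r t]; apply/eqP; rewrite eq_complex /=.
  by apply/andP; split; apply/eqP; ring.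
rewrite !rmorph_sum/=.
transitivity (\sum_(y <- s) \sum_(x <- s) \sum_(k < n) \sum_(l < n)
  (h k * h l)%:C%C * (E k x * ((E l x)^*)%C * (((E k y)^*)%C * E l y))).
  apply: eq_bigr => y _; rewrite rmorph_sum/=; apply: eq_bigr => x _.
  rewrite sqr_normc_conj /b big_distrl/=; apply: eq_bigr => k _.
  rewrite rmorph_sum mulr_sumr/=; apply: eq_bigr => l _.
  by rewrite cE rmorphM/=; ring.
transitivity (\sum_(k < n) \sum_(l < n) \sum_(y <- s) \sum_(x <- s)
  (h k * h l)%:C%C * (E k x * ((E l x)^*)%C * (((E k y)^*)%C * E l y))).
  rewrite [RHS](eq_bigr (fun k : 'I_n => \sum_(y <- s) \sum_(x <- s) \sum_(l < n)
    (h k * h l)%:C%C * (E k x * ((E l x)^*)%C * (((E k y)^*)%C * E l y)))); last first.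
    by move=> k _; rewrite exchange_big/=; apply: eq_bigr => y _; rewrite exchange_big.
  by rewrite [RHS]exchange_big/=; apply: eq_bigr => y _; rewrite exchange_big.
apply: eq_bigr => k _; rewrite rmorph_sum; apply: eq_bigr => l _.
rewrite [RHS]rmorphM/= sqr_normc_conj rmorph_sum/= big_distrlr exchange_big/= mulr_sumr.
apply: eq_bigr => y _; rewrite mulr_sumr; apply: eq_bigr => x _.
congr (_ * (_ * _)); case: (E k x) (E l x) => [p q] [r t].
by apply/eqP; rewrite eq_complex /=; apply/andP; split; apply/eqP; ring.
Qed.

(* Test rho against h = u^(theta-1), where u is rho normalised in l^theta. *)
Lemma discrete_density_bound (theta : R) : 2 < theta ->
  exists2 C : R, 0 < C & forall (s : seq T) m (a : nat -> T -> R[i]) n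
      (E : nat -> T -> R[i]) (A : R) (nu : nat -> R),
    bessel s m a -> 0 <= A ->
    (forall k l, (k < n)%N -> (l < n)%N ->
      normc (\sum_(x <- s) E k x * ((E l x)^*)%C) ^+ 2
        <= A * decay (2 / theta) (index_gap k l)) ->
    (forall j, 0 <= nu j) -> \sum_(j < m) nu j ^+ 2 <= 1 ->
    \sum_(k < n) (\sum_(j < m) nu j * normc (\sum_(x <- s) a j x * E k x) ^+ 2) `^ theta
      <= C * A `^ (theta / 2).
Proof.
move=> th2; have th0 : 0 < theta by lra.
have [C C0 HLS] := @discrete_hardy_littlewood_sobolev R theta th2.
exists (C `^ (theta / 2)); first exact: powR_gt0.
move=> s m a n E A nu B A0 EA nu0 snu.
pose P k j := normc (\sum_(x <- s) a j x * E k x) ^+ 2.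
pose rho k := \sum_(j < m) nu j * P k j.
have rho0 k : 0 <= rho k by apply: sumr_ge0 => j _; rewrite mulr_ge0// sqr_ge0.
rewrite -/(rho _); pose S := \sum_(k < n) rho k `^ theta.
rewrite -/S; have S0 : 0 <= S by apply: sumr_ge0 => k _; exact: powR_ge0.
have [->|SN0] := eqVneq S 0; first by rewrite mulr_ge0 ?powR_ge0.
have Sgt0 : 0 < S by rewrite lt0r SN0.
pose sg := S `^ theta^-1.
have sg0 : 0 < sg by exact: powR_gt0.
pose u k := rho k / sg.
have u0 k : 0 <= u k by rewrite divr_ge0// ltW.
have uth k : u k `^ theta = rho k `^ theta / S.
  rewrite /u powRM// ?invr_ge0 ?(ltW sg0)//; congr (_ * _).
  rewrite -[sg^-1]powR_inv1 ?(ltW sg0)// powRAC.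
  by rewrite {1}/sg -[(S `^ _) `^ theta]powRrM mulVf ?gt_eqF// powRr1// powR_inv1.
have su : \sum_(k < n) u k `^ theta = 1.
  by under eq_bigr do rewrite uth; rewrite -mulr_suml divff.
pose h k := u k `^ (theta - 1).
have h0 k : 0 <= h k by exact: powR_ge0.
(* The equality case of Hoelder: h_k rho_k = sg u_k^theta, so pairing [rho] with [h] recovers its
   l^theta norm [sg]. *)
have E1 : sg = \sum_(j < m) nu j * (\sum_(k < n) h k * P k j).
  transitivity (\sum_(k < n) h k * rho k).
    rewrite -[LHS]mulr1 -su mulr_sumr; apply: eq_bigr => k _.
    rewrite -(@mulr_powRB1 _ (u k) theta)// mulrA [RHS]mulrC; congr (_ * _).
    by rewrite /u mulrCA divff ?mulr1// gt_eqF.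
  under eq_bigr do rewrite mulr_sumr.
  rewrite exchange_big/=; apply: eq_bigr => j _; rewrite mulr_sumr.
  by apply: eq_bigr => k _; ring.
have E2 : sg ^+ 2 <= A * C.
  rewrite E1; apply: le_trans (cauchy_schwarz_sum _ _ _) _.
  apply: le_trans (ler_piMl _ snu) _; first by apply: sumr_ge0 => *; exact: sqr_ge0.
  apply: le_trans (hilbert_schmidt_duality _ _ _ B) _.
  apply: (@le_trans _ _ (A * \sum_(k < n) \sum_(l < n)
      h k * h l * decay (2 / theta) (index_gap k l))); last first.
    by rewrite ler_wpM2l// HLS// su.
  rewrite mulr_sumr; apply: ler_sum => k _; rewrite mulr_sumr; apply: ler_sum => l _.
  by rewrite [leRHS]mulrCA ler_wpM2l ?mulr_ge0 ?EA.
have -> : S = (sg ^+ 2) `^ (theta / 2).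
  rewrite -powR_mulrn ?(ltW sg0)// /sg -!powRrM mulrA mulrC mulrA.
  have -> : theta / 2 / theta * 2 = 1 by field; rewrite gt_eqF.
  by rewrite powRr1.
rewrite -powRM ?(ltW C0)// [C * A]mulrC.
by rewrite ge0_ler_powR ?nnegrE ?sqr_ge0 ?mulr_ge0 ?divr_ge0 ?(ltW C0) ?(ltW th0).
Qed.

End duality.

(** * Integration on the torus and Bessel's inequality *)

Section complex_integral.
Context {R : realType}.
Implicit Types (f g h : R -> R[i]) (c : R[i]).
Local Notation normc := (@Normc.normc R).
Local Notation mu := (@lebesgue_measure R).
Local Notation D := [set` @torus R].

Lemma ler_norm_Re (z : R[i]) : `|complex.Re z| <= normc z.
Proof.
rewrite -(@ler_pXn2r R 2) ?nnegrE ?normc_ge0// sqr_normc real_normK ?num_real//.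
by rewrite lerDl sqr_ge0.
Qed.

Lemma ler_norm_Im (z : R[i]) : `|complex.Im z| <= normc z.
Proof.
rewrite -(@ler_pXn2r R 2) ?nnegrE ?normc_ge0// sqr_normc real_normK ?num_real//.
by rewrite lerDr sqr_ge0.
Qed.

Lemma ReD (z w : R[i]) : complex.Re (z + w) = complex.Re z + complex.Re w.
Proof. by case: z w => [a b] [c d]. Qed.

Lemma ImD (z w : R[i]) : complex.Im (z + w) = complex.Im z + complex.Im w.
Proof. by case: z w => [a b] [c d]. Qed.

Lemma measurable_torus : measurable (D : set (measurableTypeR R)).
Proof. exact: measurable_itv. Qed.
Hint Resolve measurable_torus : core.

Lemma lebesgue_torus : mu D = 1%:E.
Proof. by rewrite lebesgue_measure_itv/= lte_fin ltr01 oppr0 adde0. Qed.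

Definition cmeasurable f := measurable_fun D (fun x => complex.Re (f x)) /\
  measurable_fun D (fun x => complex.Im (f x)).

Definition cintegrable f := mu.-integrable D (fun x => (complex.Re (f x))%:E) /\
  mu.-integrable D (fun x => (complex.Im (f x))%:E).

Definition sqintegrable f := cmeasurable f /\
  mu.-integrable D (fun x => (normc (f x) ^+ 2)%:E).

Lemma cmeasurableD f g : cmeasurable f -> cmeasurable g ->
  cmeasurable (fun x => f x + g x).
Proof.
move=> [f1 f2] [g1 g2]; split => /=.
  rewrite (_ : (fun x => _) = (fun x => complex.Re (f x) + complex.Re (g x))).
    exact: measurable_funD.
  by apply/funext => x; rewrite ReD.
rewrite (_ : (fun x => _) = (fun x => complex.Im (f x) + complex.Im (g x))).
  exact: measurable_funD.
by apply/funext => x; rewrite ImD.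
Qed.

Lemma cmeasurableM f g : cmeasurable f -> cmeasurable g ->
  cmeasurable (fun x => f x * g x).
Proof.
move=> [f1 f2] [g1 g2]; split => /=.
  have -> : (fun x => complex.Re (f x * g x)) =
      (fun x => complex.Re (f x) * complex.Re (g x) - complex.Im (f x) * complex.Im (g x)).
    by apply/funext => x; case: (f x) (g x) => [a b] [c d].
  by apply: measurable_funB; exact: measurable_funM.
have -> : (fun x => complex.Im (f x * g x)) =
    (fun x => complex.Re (f x) * complex.Im (g x) + complex.Im (f x) * complex.Re (g x)).
  by apply/funext => x; case: (f x) (g x) => [a b] [c d].
by apply: measurable_funD; exact: measurable_funM.
Qed.

Lemma cmeasurable_conj f : cmeasurable f -> cmeasurable (fun x => ((f x)^*)%C).
Proof.
move=> [f1 f2]; split => /=.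
  have -> // : (fun x => complex.Re ((f x)^*)%C) = (fun x => complex.Re (f x)).
  by apply/funext => x; case: (f x).
have -> : (fun x => complex.Im ((f x)^*)%C) = (fun x => - complex.Im (f x)).
  by apply/funext => x; case: (f x).
exact: measurableT_comp.
Qed.

Lemma cmeasurable_cst c : cmeasurable (fun=> c).
Proof. by split; exact: measurable_cst. Qed.

Lemma cmeasurable_sum (I : Type) (s : seq I) (F : I -> R -> R[i]) :
  (forall i, cmeasurable (F i)) -> cmeasurable (fun x => \sum_(i <- s) F i x).
Proof.
move=> mF; elim: s => [|i s IH].
  by rewrite (_ : (fun x => _) = fun=> 0); [exact: cmeasurable_cst|apply/funext => x; rewrite big_nil].
rewrite (_ : (fun x => _) = (fun x => F i x + \sum_(j <- s) F j x)).
  exact: cmeasurableD.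
by apply/funext => x; rewrite big_cons.
Qed.

Lemma measurable_sqr_normc f : cmeasurable f ->
  measurable_fun D (fun x => normc (f x) ^+ 2).
Proof.
move=> [f1 f2]; rewrite (_ : (fun x => _) = (fun x => complex.Re (f x) ^+ 2 + complex.Im (f x) ^+ 2)); last first.
  by apply/funext => x; rewrite sqr_normc.
by apply: measurable_funD; exact: measurable_funX.
Qed.

Lemma cintegrable_le f (g : R -> R) : cmeasurable f ->
  mu.-integrable D (fun x => (g x)%:E) -> (forall x, normc (f x) <= g x) ->
  cintegrable f.
Proof.
move=> [f1 f2] ig fg; split; apply: le_integrable ig => //.
- exact/measurable_EFinP.
- move=> x _ /=; rewrite lee_fin; apply: le_trans (ler_norm_Re _) _.
  exact: le_trans (fg x) (ler_norm _).
- exact/measurable_EFinP.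
- move=> x _ /=; rewrite lee_fin; apply: le_trans (ler_norm_Im _) _.
  exact: le_trans (fg x) (ler_norm _).
Qed.

Lemma sqintegrableM f g : sqintegrable f -> sqintegrable g ->
  cintegrable (fun x => f x * ((g x)^*)%C).
Proof.
move=> [mf i_f] [mg i_g].
apply: (@cintegrable_le _ (fun x => normc (f x) ^+ 2 + normc (g x) ^+ 2)).
- by apply: cmeasurableM => //; exact: cmeasurable_conj.
- exact: (integrableD measurable_torus i_f i_g).
- move=> x; rewrite Normc.normcM normc_conj.
  have := sqr_ge0 (normc (f x) - normc (g x)).
  have := normc_ge0 (f x); have := normc_ge0 (g x); nra.
Qed.

Lemma sqintegrable_bounded f (M : R) : cmeasurable f ->
  (forall x, normc (f x) <= M) -> sqintegrable f.
Proof.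
move=> mf fM; split=> //.
apply/integrableP; split; first by apply/measurable_EFinP; exact: measurable_sqr_normc.
apply: (@le_lt_trans _ _ ((M ^+ 2)%:E * mu D)%E); last by rewrite lebesgue_torus mule1 ltry.
rewrite -integral_cst//; apply: ge0_le_integral => //.
- apply: measurableT_comp => //; apply/measurable_EFinP.
  exact: measurable_sqr_normc.
- move=> x _ /=; rewrite lee_fin ger0_norm ?sqr_ge0// ler_pXn2r// nnegrE ?normc_ge0//.
  exact: le_trans (normc_ge0 (f x)) (fM x).
Qed.

Lemma eq_cintegral f g : f =1 g -> cintegral D f = cintegral D g.
Proof. by move=> fg; congr cintegral; exact/funext. Qed.

Lemma cintegrableD f g : cintegrable f -> cintegrable g ->
  cintegrable (fun x => f x + g x).
Proof.
move=> [f1 f2] [g1 g2]; split => /=.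
  rewrite (_ : (fun x => _) = (fun x => (complex.Re (f x))%:E + (complex.Re (g x))%:E)%E).
    exact: integrableD.
  by apply/funext => x; rewrite ReD.
rewrite (_ : (fun x => _) = (fun x => (complex.Im (f x))%:E + (complex.Im (g x))%:E)%E).
  exact: integrableD.
by apply/funext => x; rewrite ImD.
Qed.

Lemma cintegralD f g : cintegrable f -> cintegrable g ->
  cintegral D (fun x => f x + g x) = cintegral D f + cintegral D g.
Proof.
move=> [f1 f2] [g1 g2]; rewrite /cintegral.
under eq_Rintegral do rewrite ReD.
under [in X in (_ +i* X)%C]eq_Rintegral do rewrite ImD.
by rewrite !RintegralD.
Qed.

Lemma ReM (z w : R[i]) : complex.Re (z * w) =
  complex.Re z * complex.Re w - complex.Im z * complex.Im w.
Proof. by case: z w => [a b] [c d]. Qed.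

Lemma ImM (z w : R[i]) : complex.Im (z * w) =
  complex.Re z * complex.Im w + complex.Im z * complex.Re w.
Proof. by case: z w => [a b] [c d]. Qed.

Lemma cintegrableZ c f : cintegrable f -> cintegrable (fun x => c * f x).
Proof.
move=> [f1 f2]; split => /=.
  rewrite (_ : (fun x => _) = (fun x => (complex.Re c)%:E * (complex.Re (f x))%:E
      - (complex.Im c)%:E * (complex.Im (f x))%:E)%E).
    by apply: integrableB => //; exact: integrableZl.
  by apply/funext => x; rewrite ReM EFinB !EFinM.
rewrite (_ : (fun x => _) = (fun x => (complex.Re c)%:E * (complex.Im (f x))%:E
    + (complex.Im c)%:E * (complex.Re (f x))%:E)%E).
  by apply: integrableD => //; exact: integrableZl.
by apply/funext => x; rewrite ImM EFinD !EFinM.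
Qed.

Lemma cintegralZ c f : cintegrable f ->
  cintegral D (fun x => c * f x) = c * cintegral D f.
Proof.
move=> [f1 f2]; rewrite /cintegral.
under eq_Rintegral do rewrite ReM.
under [in X in (_ +i* X)%C]eq_Rintegral do rewrite ImM.
rewrite RintegralB// ?RintegralD ?RintegralZl//.
- by case: c.
- exact: integrableZl f2.
- exact: integrableZl f1.
- exact: integrableZl f1.
- exact: integrableZl f2.
Qed.

Lemma cintegrable0 : cintegrable (fun=> 0).
Proof. by split; exact: integrable0. Qed.

Lemma cintegral0 : cintegral D (fun=> 0) = 0 :> R[i].
Proof. by rewrite /cintegral /Rintegral/= !integral0. Qed.

Lemma cintegrable_sum (I : Type) (s : seq I) (P : pred I) (F : I -> R -> R[i]) :
  (forall i, P i -> cintegrable (F i)) ->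
  cintegrable (fun x => \sum_(i <- s | P i) F i x).
Proof.
move=> iF; elim: s => [|i s IH].
  by rewrite (_ : (fun x => _) = fun=> 0); [exact: cintegrable0|apply/funext => x; rewrite big_nil].
case: (boolP (P i)) => Pi.
  rewrite (_ : (fun x => _) = (fun x => F i x + \sum_(j <- s | P j) F j x)).
    by apply: cintegrableD => //; exact: iF.
  by apply/funext => x; rewrite big_cons Pi.
rewrite (_ : (fun x => _) = (fun x => \sum_(j <- s | P j) F j x))//.
by apply/funext => x; rewrite big_cons (negbTE Pi).
Qed.

Lemma cintegral_sum (I : Type) (s : seq I) (P : pred I) (F : I -> R -> R[i]) :
  (forall i, P i -> cintegrable (F i)) ->
  cintegral D (fun x => \sum_(i <- s | P i) F i x) = \sum_(i <- s | P i) cintegral D (F i).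
Proof.
move=> iF; elim: s => [|i s IH].
  by rewrite big_nil -[RHS]cintegral0; apply: eq_cintegral => x; rewrite big_nil.
rewrite big_cons -IH; case: ifPn => Pi.
  rewrite -cintegralD; [|exact: iF|exact: cintegrable_sum].
  by apply: eq_cintegral => x; rewrite big_cons Pi.
by apply: eq_cintegral => x; rewrite big_cons (negbTE Pi).
Qed.

Lemma cintegral_conj f : cintegrable f ->
  cintegral D (fun x => ((f x)^*)%C) = ((cintegral D f)^*)%C.
Proof.
move=> [f1 f2]; rewrite /cintegral/=; congr (_ +i* _)%C.
  by apply: eq_Rintegral => x _; case: (f x).
rewrite -mulN1r -RintegralZl//; apply: eq_Rintegral => x _; rewrite mulN1r.
by case: (f x).
Qed.

Lemma integral_sqr_normc f : sqintegrable f ->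
  (\int[mu]_(x in D) (normc (f x) ^+ 2)%:E =
   (complex.Re (cintegral D (fun x => f x * ((f x)^*)%C)))%:E)%E.
Proof.
move=> [mf i_f]; rewrite /cintegral/= /Rintegral.
have E : (\int[mu]_(x in D) (normc (f x) ^+ 2)%:E =
    \int[mu]_(x in D) (complex.Re (f x * ((f x)^*)%C))%:E)%E.
  by apply: eq_integral => x _; congr EFin; rewrite -sqr_normc_conj.
by rewrite -E fineK//; exact: integrable_fin_num.
Qed.

End complex_integral.

(** * Parseval for trigonometric polynomials and Bessel's inequality *)

Section torus_bessel.
Context {R : realType}.
Implicit Types (f g h : R -> R[i]) (c : R[i]).
Local Notation normc := (@Normc.normc R).
Local Notation mu := (@lebesgue_measure R).
Local Notation D := [set` @torus R].

Lemma conjcM (z w : R[i]) : ((z * w)^*)%C = ((z^*)%C * (w^*)%C).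
Proof. exact: rmorphM. Qed.

Lemma conj1c : ((1 : R[i])^*)%C = 1.
Proof. exact: rmorph1. Qed.

Lemma conjc_sum (I : Type) (r : seq I) (Q : pred I) (F : I -> R[i]) :
  ((\sum_(i <- r | Q i) F i)^*)%C = \sum_(i <- r | Q i) ((F i)^*)%C.
Proof. exact: rmorph_sum. Qed.

Definition fourier_mode (xi : int) (x : R) : R[i] := cexp (2 * pi * x * xi%:~R).

Lemma cmeasurable_fourier_mode xi : cmeasurable (fourier_mode xi).
Proof.
have cl : continuous (fun x : R => 2 * pi * x * xi%:~R).
  move=> x; apply: cvgM; last exact: cvg_cst.
  by apply: cvgM; [exact: cvg_cst|exact: cvg_id].
split; apply: measurable_funTS; apply: continuous_measurable_fun => x /=;
  (apply: continuous_comp; first exact: cl).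
  exact: continuous_cos.
exact: continuous_sin.
Qed.

Lemma sqintegrable_fourier_mode xi : sqintegrable (fourier_mode xi).
Proof.
apply: (@sqintegrable_bounded _ _ 1); first exact: cmeasurable_fourier_mode.
by move=> x; rewrite /fourier_mode normc_cexp.
Qed.

Lemma Rintegral_torus_derive (F F' : R -> R) : continuous F' ->
  (forall x : R, is_derive x 1 F (F' x)) -> Rintegral mu D F' = F 1 - F 0.
Proof.
move=> cF' dF; rewrite Rintegral_itv_bndo_bndc; last first.
  have ic : mu.-integrable `[0, 1] (EFin \o F').
    apply: continuous_compact_integrable; first exact: segment_compact.
    exact: continuous_subspaceT.
  by apply: integrableS ic => //; apply: subset_itvl; rewrite bnd_simp.
have cF : continuous F.
  by move=> x; apply: differentiable_continuous; apply/derivable1_diffP; case: (dF x).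
rewrite /Rintegral (@continuous_FTC2 _ F' F)//.
- exact: continuous_subspaceT.
- split; first by move=> x _; case: (dF x).
  + exact/cvg_at_right_filter/cF.
  + exact/cvg_at_left_filter/cF.
- by move=> x _; rewrite derive1E derive_val.
Qed.

Lemma cintegral_fourier_mode xi : cintegral D (fourier_mode xi) = (xi == 0)%:R.
Proof.
have [->|xi0] := eqVneq xi 0.
  rewrite (@eq_cintegral _ _ (fun=> 1)); last first.
    by move=> x; rewrite /fourier_mode mulr0 cexp0.
  rewrite /cintegral Rintegral_cst// Rintegral_cst//= -[[set` _]]/D.
  by rewrite lebesgue_torus mulr1 mul0r.
have k0 : xi%:~R != 0 :> R by rewrite intr_eq0.
pose k : R := 2 * pi * xi%:~R.
have k00 : k != 0 by rewrite !mulf_neq0// gt_eqF// pi_gt0.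
have dk (x : R) : is_derive x 1 (fun x : R => 2 * pi * x * xi%:~R) k.
  have -> : (fun x : R => 2 * pi * x * xi%:~R) = (fun x => k *: x).
    by apply/funext => y; rewrite /k /GRing.scale/=; ring.
  by have := is_deriveZ k (is_derive_id x 1); rewrite /GRing.scale/= mulr1.
have cl : continuous (fun x : R => 2 * pi * x * xi%:~R).
  by move=> x; apply: differentiable_continuous; apply/derivable1_diffP; case: (dk x).
(* Its two components say that the primitives below take equal values at 0 and 1. *)
have c2 : cexp (2 * pi * 1 * xi%:~R) = 1 :> R[i] by rewrite mulr1 cexp2piz.
case: c2 => c2 s2.
have I1 : Rintegral mu D (fun x : R => cos (2 * pi * x * xi%:~R)) = 0.
  apply: etrans (@Rintegral_torus_derive (fun x : R => k^-1 * sin (2 * pi * x * xi%:~R))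
    (fun x : R => cos (2 * pi * x * xi%:~R)) _ _) _.
  - by move=> x; apply: continuous_comp; [exact: cl|exact: continuous_cos].
  - move=> x.
    have h := @is_derive1_comp R sin (fun x : R => 2 * pi * x * xi%:~R) x _ _ (is_derive_sin _) (dk x).
    by apply: (is_derive_eq (is_deriveZ k^-1 h)); rewrite /GRing.scale/=; field.
  - by rewrite s2 !(mulr0, mul0r) sin0 mulr0 subrr.
have I2 : Rintegral mu D (fun x : R => sin (2 * pi * x * xi%:~R)) = 0.
  apply: etrans (@Rintegral_torus_derive (fun x : R => - k^-1 * cos (2 * pi * x * xi%:~R))
    (fun x : R => sin (2 * pi * x * xi%:~R)) _ _) _.
  - by move=> x; apply: continuous_comp; [exact: cl|exact: continuous_sin].
  - move=> x.
    have h := @is_derive1_comp R cos (fun x : R => 2 * pi * x * xi%:~R) x _ _ (is_derive_cos _) (dk x).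
    by apply: (is_derive_eq (is_deriveZ (- k^-1) h)); rewrite /GRing.scale/=; field.
  - by rewrite c2 !(mulr0, mul0r) cos0 subrr.
have -> : cintegral D (fourier_mode xi) =
  (Rintegral mu D (fun x : R => cos (2 * pi * x * xi%:~R))
   +i* Rintegral mu D (fun x : R => sin (2 * pi * x * xi%:~R)))%C by [].
by rewrite I1 I2.
Qed.

Lemma L2_sqintegrable f : L2_torus f -> sqintegrable f.
Proof.
move=> [_ m1 m2 fi].
have mf : cmeasurable f by split; exact: measurable_funTS.
split=> //; apply/integrableP; split.
  by apply/measurable_EFinP; exact: measurable_sqr_normc.
by under eq_integral do rewrite gee0_abs ?lee_fin ?sqr_ge0//.
Qed.

Definition trig_poly (s : seq int) (b : int -> R[i]) (x : R) : R[i] :=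
  \sum_(xi <- s) b xi * fourier_mode xi x.

Lemma sqintegrable_trig_poly s b : sqintegrable (trig_poly s b).
Proof.
apply: (@sqintegrable_bounded _ _ (\sum_(xi <- s) normc (b xi))).
  apply: cmeasurable_sum => xi; apply: cmeasurableM; first exact: cmeasurable_cst.
  exact: cmeasurable_fourier_mode.
move=> x; apply: le_trans (ler_normc_sum _ _ _) _.
by apply: ler_sum => xi _; rewrite Normc.normcM normc_cexp mulr1.
Qed.

Lemma cintegral_trig_poly (s : seq int) b : uniq s ->
  cintegral D (fun x => trig_poly s b x * ((trig_poly s b x)^*)%C)
  = (\sum_(xi <- s) normc (b xi) ^+ 2)%:C%C.
Proof.
move=> us.
rewrite (@eq_cintegral _ _ (fun x => \sum_(xi <- s) \sum_(eta <- s)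
   (b xi * ((b eta)^*)%C) * fourier_mode (xi - eta) x)); last first.
  move=> x; rewrite /trig_poly conjc_sum big_distrlr/=; apply: eq_bigr => xi _.
  apply: eq_bigr => eta _; rewrite conjcM mulrACA; congr (_ * _).
  by rewrite /fourier_mode -cexpN -cexpD intrB; congr cexp; ring.
have im xi : cintegrable (fourier_mode xi).
  have := sqintegrableM (sqintegrable_fourier_mode xi) (sqintegrable_fourier_mode 0).
  congr cintegrable; apply/funext => x.
  by rewrite /fourier_mode mulr0 cexp0 conj1c mulr1.
rewrite cintegral_sum; last first.
  by move=> xi _; apply: cintegrable_sum => eta _; exact: cintegrableZ.
rewrite rmorph_sum/= [LHS]big_seq [RHS]big_seq; apply: eq_bigr => xi xis.
rewrite cintegral_sum; last by move=> eta _; exact: cintegrableZ.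
rewrite (bigD1_seq xi)//= cintegralZ// cintegral_fourier_mode subrr eqxx mulr1.
rewrite big1 ?addr0 ?sqr_normc_conj// => eta etaxi.
by rewrite cintegralZ// cintegral_fourier_mode subr_eq0 eq_sym (negbTE etaxi) mulr0.
Qed.

Lemma integral_trig_poly (s : seq int) b : uniq s ->
  (\int[mu]_(x in D) (normc (trig_poly s b x) ^+ 2)%:E
   = (\sum_(xi <- s) normc (b xi) ^+ 2)%:E)%E.
Proof.
move=> us; rewrite integral_sqr_normc; last exact: sqintegrable_trig_poly.
by rewrite cintegral_trig_poly.
Qed.

(** For g with Fourier coefficients conj(v), the number c_j = <f_j, g> is the sum to be bounded, and
    ||g||^2 is the right-hand side by Parseval. The claim is then 0 <= ||g - F||^2, where F = sum_j
    conj(c_j) f_j is the projection of g onto the system. Indices outside J give zero rows. *)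
Lemma bessel_fourier_coef (J : set nat) (f : nat -> R -> R[i]) (s : seq int) m :
  uniq s -> orthonormal_system J f ->
  bessel s m (fun j xi => if `[< J j >] then fourier_coef (f j) xi else 0).
Proof.
move=> us [fL2 fon] v.
pose P (j : 'I_m) := `[< J j >].
have fsq j : P j -> sqintegrable (f j) by move=> /asboolP/fL2/L2_sqintegrable.
pose g := trig_poly s (fun xi => ((v xi)^*)%C).
have gsq : sqintegrable g by exact: sqintegrable_trig_poly.
pose c (j : 'I_m) := cintegral D (fun x => f j x * ((g x)^*)%C).
have cE j : P j -> c j = \sum_(xi <- s) fourier_coef (f j) xi * v xi.
  move=> Pj; rewrite /c.
  rewrite (@eq_cintegral _ _ (fun x => \sum_(xi <- s) v xi * (f j x * ((fourier_mode xi x)^*)%C))).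
    have ifm xi : cintegrable (fun x => f j x * ((fourier_mode xi x)^*)%C).
      exact: sqintegrableM (fsq _ Pj) (sqintegrable_fourier_mode xi).
    rewrite cintegral_sum; last by move=> xi _; exact: cintegrableZ.
    apply: eq_bigr => xi _; rewrite cintegralZ// mulrC; congr (_ * _).
    by apply: eq_cintegral => x; rewrite /fourier_mode cexpN.
  move=> x; rewrite /g /trig_poly conjc_sum mulr_sumr; apply: eq_bigr => xi _.
  by rewrite conjcM conjcK mulrCA.
pose F x := \sum_(j < m | P j) ((c j)^*)%C * f j x.
pose H x := g x - F x.
have Hpos : 0 <= complex.Re (cintegral D (fun x => H x * ((H x)^*)%C)).
  rewrite /cintegral/=; apply: Rintegral_ge0 => x _.
  by rewrite -sqr_normc_conj/= sqr_ge0.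
have i_fg j : P j -> cintegrable (fun x => f j x * ((g x)^*)%C).
  by move=> Pj; exact: sqintegrableM (fsq _ Pj) gsq.
have i_gf j : P j -> cintegrable (fun x => g x * ((f j x)^*)%C).
  by move=> Pj; exact: sqintegrableM gsq (fsq _ Pj).
have i_ff j k : P j -> P k -> cintegrable (fun x => f j x * ((f k x)^*)%C).
  by move=> Pj Pk; exact: sqintegrableM (fsq _ Pj) (fsq _ Pk).
have E : cintegral D (fun x => H x * ((H x)^*)%C) =
    cintegral D (fun x => g x * ((g x)^*)%C)
    - \sum_(j < m | P j) ((c j)^*)%C * c j.
  rewrite (@eq_cintegral _ _ (fun x => g x * ((g x)^*)%C +
    (\sum_(j < m | P j) (- ((c j)^*)%C) * (f j x * ((g x)^*)%C) +
     (\sum_(j < m | P j) (- c j) * (g x * ((f j x)^*)%C) +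
      \sum_(j < m | P j) \sum_(k < m | P k) (((c j)^*)%C * c k) * (f j x * ((f k x)^*)%C))))); last first.
    move=> x; rewrite /H rmorphB mulrBl !mulrBr.
    have E1 : F x * ((g x)^*)%C = \sum_(j < m | P j) ((c j)^*)%C * (f j x * ((g x)^*)%C).
      by rewrite mulr_suml; apply: eq_bigr => j _; rewrite mulrA.
    have E2 : g x * ((F x)^*)%C = \sum_(j < m | P j) c j * (g x * ((f j x)^*)%C).
      rewrite conjc_sum mulr_sumr; apply: eq_bigr => j _.
      by rewrite conjcM conjcK mulrCA.
    have E3 : F x * ((F x)^*)%C = \sum_(j < m | P j) \sum_(k < m | P k)
        (((c j)^*)%C * c k) * (f j x * ((f k x)^*)%C).
      rewrite conjc_sum big_distrlr; apply: eq_bigr => j _; apply: eq_bigr => k _.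
      rewrite -[LHS]/((((c j)^*)%C * f j x) * ((((c k)^*)%C * f k x)^*)%C).
      by rewrite conjcM conjcK mulrACA.
    rewrite E1 E2 E3.
    under [in RHS]eq_bigr do rewrite mulNr.
    under [X in _ = _ + (_ + (X + _))]eq_bigr do rewrite mulNr.
    by rewrite !sumrN; ring.
  have s1 : cintegrable (fun x => \sum_(j < m | P j) \sum_(k < m | P k)
      (((c j)^*)%C * c k) * (f j x * ((f k x)^*)%C)).
    apply: cintegrable_sum => j Pj; apply: cintegrable_sum => k Pk.
    exact/cintegrableZ/i_ff.
  have s2 : cintegrable (fun x => \sum_(j < m | P j) (- c j) * (g x * ((f j x)^*)%C)).
    by apply: cintegrable_sum => j Pj; exact/cintegrableZ/i_gf.
  have s3 : cintegrable (fun x => \sum_(j < m | P j) (- ((c j)^*)%C) * (f j x * ((g x)^*)%C)).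
    by apply: cintegrable_sum => j Pj; exact/cintegrableZ/i_fg.
  have s4 : cintegrable (fun x => g x * ((g x)^*)%C) by exact: sqintegrableM.
  rewrite cintegralD//; last by apply: cintegrableD => //; exact: cintegrableD.
  rewrite cintegralD//; last exact: cintegrableD.
  rewrite cintegralD//; congr (_ + _).
  rewrite cintegral_sum; last by move=> j Pj; exact/cintegrableZ/i_fg.
  rewrite cintegral_sum; last by move=> j Pj; exact/cintegrableZ/i_gf.
  rewrite cintegral_sum; last first.
    move=> j Pj; apply: cintegrable_sum => k Pk; exact/cintegrableZ/i_ff.
  rewrite -sumrN -!big_split/=; apply: eq_bigr => j Pj.
  rewrite cintegralZ; last exact: i_fg.
  rewrite cintegralZ; last exact: i_gf.
  have -> : cintegral D (fun x => g x * ((f j x)^*)%C) = ((c j)^*)%C.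
    rewrite /c -cintegral_conj; last exact: i_fg.
    by apply: eq_cintegral => x; rewrite conjcM conjcK mulrC.
  rewrite cintegral_sum; last by move=> k Pk; exact/cintegrableZ/i_ff.
  rewrite (bigD1 j)//= big1 ?addr0.
    rewrite cintegralZ; last exact: i_ff.
    have := fon j j (asboolW Pj) (asboolW Pj); rewrite /inner_torus eqxx => ->.
    by rewrite -/(c j) mulr1; ring.
  move=> k /andP[Pk kj]; rewrite cintegralZ; last exact: i_ff.
  have := fon j k (asboolW Pj) (asboolW Pk); rewrite /inner_torus => ->.
  by rewrite eq_sym (_ : (k == j :> nat) = false) ?mulr0//; exact: negbTE.
have main : \sum_(j < m | P j) normc (c j) ^+ 2 <= \sum_(xi <- s) normc (((v xi)^*)%C) ^+ 2.
  move: Hpos; rewrite E cintegral_trig_poly//.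
  have -> : \sum_(j < m | P j) ((c j)^*)%C * c j = (\sum_(j < m | P j) normc (c j) ^+ 2)%:C%C.
    by rewrite rmorph_sum/=; apply: eq_bigr => j _; rewrite [RHS](sqr_normc_conj (c j)) mulrC.
  by rewrite -rmorphB/= subr_ge0.
apply: le_trans.
  2: apply: le_trans main _; by under eq_bigr do rewrite normc_conj.
rewrite [leRHS]big_mkcond; apply: ler_sum => j _.
case: (boolP (`[< J j >])) => Jj.
  by rewrite {1}/P Jj cE.
rewrite {1}/P (negbTE Jj) big1 ?Normc.normc0 ?expr0n//.
by move=> xi _; rewrite mul0r.
Qed.

End torus_bessel.

(** * Space-time estimates *)

Section space_time_cells.
Context {R : realType}.
Implicit Types (theta N t x : R).
Local Notation normc := (@Normc.normc R).

Lemma mem_frequencies n (xi : int) : (xi \in frequencies n) = (absz xi <= n)%N.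
Proof.
rewrite mem_cat; apply/idP/idP.
  by case/orP => /mapP[k]; rewrite mem_iota/= => kn ->/=; lia.
case: xi => k kn; apply/orP; [left|right]; apply/mapP; exists k => //;
  by rewrite mem_iota/= ?add0n ?ltnS.
Qed.

Lemma uniq_frequencies n : uniq (frequencies n).
Proof.
rewrite cat_uniq !map_inj_uniq ?iota_uniq ?andbT/=; [|by move=> ? ? []|by move=> ? ? []].
by apply/hasPn => xi /mapP[k _ ->]; apply/negP => /mapP[].
Qed.

Lemma size_frequencies n : size (frequencies n) = (n.+1 + n)%N.
Proof. by rewrite size_cat !size_map !size_iota. Qed.

Definition wave theta t x (xi : int) : R[i] :=
  cexp (2 * pi * (t * (`|xi%:~R : R| `^ theta) + x * xi%:~R)).

(** An integer lies in [-N, N] exactly when its modulus is at most the integer part of N, so the sum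
    over all integers has finite support and becomes a sum over a list. *)
Lemma schrodinger_cutoffE theta N t (f : R -> R[i]) x : 0 <= N ->
  schrodinger_cutoff theta N t f x =
  trig_poly (frequencies (Num.truncn N))
    (fun xi => schrodinger_symbol theta t xi * fourier_coef f xi) x.
Proof.
move=> N0; set n := Num.truncn N.
have cutE xi : cutoff_symbol N xi = ((xi \in frequencies n)%:R : R[i]).
  rewrite /cutoff_symbol mem_frequencies -ler_norml -intr_norm -abszE -pmulrn.
  by rewrite /n truncn_ge_nat//; case: ifP.
rewrite /schrodinger_cutoff /fourier_multiplier.
rewrite -(fsbig_widen [set` frequencies n] setT)//=.
  rewrite -fsbig_seq ?uniq_frequencies//; apply: eq_big_seq => xi xin.
  by rewrite cutE xin mulr1.
by move=> xi [_ /= /negP xin]; rewrite cutE (negbTE xin) mulr0 !mul0r.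
Qed.

Lemma schrodinger_cutoff_wave theta N t (f : R -> R[i]) x : 0 <= N ->
  schrodinger_cutoff theta N t f x =
  \sum_(xi <- frequencies (Num.truncn N)) fourier_coef f xi * wave theta t x xi.
Proof.
move=> N0; rewrite schrodinger_cutoffE//; apply: eq_bigr => xi _.
rewrite /schrodinger_symbol /fourier_mode /wave mulrAC -cexpD mulrC; congr (_ * cexp _).
by ring.
Qed.

Lemma wave_conj theta t s x y xi :
  wave theta t x xi * ((wave theta s y xi)^*)%C = wave theta (t - s) (x - y) xi.
Proof. by rewrite /wave -cexpN -cexpD; congr cexp; ring. Qed.

Lemma normc_wave theta t x xi : normc (wave theta t x xi) = 1.
Proof. exact: normc_cexp. Qed.

(** The successor keeps the count positive and between N and 2N, so cells have length comparable to
    c N^(-theta). *)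
Definition cell_count N : nat := (Num.truncn N).+1.
Definition cell_length c theta N : R := c * N `^ (1 - theta) / (cell_count N)%:R.

Lemma cell_count_bounds N : 1 < N -> N <= (cell_count N)%:R <= 2 * N.
Proof.
move=> N1; have /andP[a b] := truncn_itv (ltW (lt_trans ltr01 N1)).
rewrite (ltW b)/= /cell_count -addn1 natrD; lra.
Qed.

(** Times in cells at distance d >= 2 differ by at least d-1 >= d/2 cell lengths and at most one
    block, so the dispersive estimate applies. For d <= 1 the times may coincide, and only the
    trivial bound 2N+1 <= 3N is available. The positions x are arbitrary because the dispersive
    estimate is uniform in x. *)
Lemma wave_kernel_decay theta : 2 < theta ->
  exists C c : R, [/\ 0 < C, 0 < c <= 1 & forall N t0 (t x : nat -> R), 1 < N ->
    (forall k, (k < cell_count N)%N ->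
      t0 + k%:R * cell_length c theta N <= t k <= t0 + k.+1%:R * cell_length c theta N) ->
    forall k l, (k < cell_count N)%N -> (l < cell_count N)%N ->
    normc (\sum_(xi <- frequencies (Num.truncn N))
        wave theta (t k) (x k) xi * ((wave theta (t l) (x l) xi)^*)%C) ^+ 2
      <= C * N ^+ 2 * decay (2 / theta) (index_gap k l)].
Proof.
move=> th2; have th0 : 0 < theta by lra.
have [C [c [C0 c01 disp]]] := @dispersive_estimate R theta th2.
have [c0 c1] := andP c01.
(* One factor 1/2 comes from d-1 >= d/2, the other from a cell count of at most 2N. *)
pose C1 := C * (c / 4) `^ (- theta^-1).
have C10 : 0 < C1 by rewrite mulr_gt0// powR_gt0// divr_gt0.
exists (9 + C1 ^+ 2), c; split => //; first by rewrite addr_gt0// exprn_gt0.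
move=> N t0 t x N1 tcell k l kK lK.
have N0 : 0 < N by lra.
set K := cell_count N in tcell kK lK.
set e := cell_length c theta N in tcell.
have /andP[NK K2] := cell_count_bounds N1; rewrite -/K in NK K2.
have K0 : 0 < K%:R :> R by rewrite ltr0n.
have e0 : 0 < e by rewrite divr_gt0// mulr_gt0// powR_gt0.
have Ke : K%:R * e = c * N `^ (1 - theta) by rewrite /e /cell_length mulrC divfK// gt_eqF.
have nN : (Num.truncn N)%:R <= N by have /andP[] := truncn_itv (ltW N0).
under eq_bigr do rewrite wave_conj.
have [dle|dgt] := leqP (index_gap k l) 1.
  have -> : decay (2 / theta) (index_gap k l) = 1 :> R.
    rewrite /decay (_ : maxn 1 _ = 1%N) ?powR1//.
    by apply/maxn_idPl.
  rewrite mulr1 mulrDl ler_wpDr ?(mulr_ge0 (sqr_ge0 _) (sqr_ge0 _))//.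
  have -> : 9 * N ^+ 2 = (3 * N) ^+ 2 by rewrite exprMn -natrX.
  rewrite ler_pXn2r ?nnegrE ?normc_ge0 ?mulr_ge0 ?(ltW N0)//.
  apply: le_trans (ler_normc_sum _ _ _) _.
  rewrite (eq_bigr (fun=> 1)); last by move=> xi _; rewrite normc_wave.
  rewrite big_const_seq count_predT size_frequencies iter_addr_0 natrD -addn1 natrD.
  lra.
set d := index_gap k l in dgt *.
have d0 : (0 < d)%N by exact: ltnW.
have d0' : 0 < d%:R :> R by rewrite ltr0n.
have far i j : (i < K)%N -> (j < K)%N -> (i <= j)%N -> (1 < index_gap i j)%N ->
    (index_gap i j)%:R * e / 2 <= `|t i - t j| <= K%:R * e.
  move=> iK jK ij dg.
  have dE : (index_gap i j)%:R = j%:R - i%:R :> R.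
    by rewrite -natrB//; congr (_%:R); rewrite /index_gap (eqP ij) add0n.
  have /andP[a1 a2] := tcell _ iK; have /andP[b1 b2] := tcell _ jK.
  have d2 : 2 <= (index_gap i j)%:R :> R by rewrite ler_nat.
  have lK' : j.+1%:R <= K%:R :> R by rewrite ler_nat.
  have k0 : 0 <= i%:R :> R by [].
  rewrite -[i.+1]addn1 natrD in a2.
  rewrite -[j.+1]addn1 natrD in b2 lK'.
  have h1 : (j%:R + 1) * e <= K%:R * e by rewrite ler_pM2r.
  have h2 : 0 <= i%:R * e by rewrite mulr_ge0// ltW.
  have h3 : 2 * e <= (index_gap i j)%:R * e by rewrite ler_pM2r.
  rewrite dE in h3 *.
  have tt : t i - t j <= 0 by move: a2 b1 h3; clear -e0; lra.
  by rewrite ler0_norm//; apply/andP; split; move: a1 a2 b1 b2 h1 h2 h3; clear; lra.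
have {}far : d%:R * e / 2 <= `|t k - t l| <= K%:R * e.
  have [kl|/ltnW lk] := leqP k l; first exact: far.
  by rewrite distrC /d index_gapC; apply: far => //; rewrite index_gapC.
have /andP[f1 f2] := far.
have tkl0 : t k - t l != 0.
  rewrite -normr_gt0; apply: lt_le_trans f1.
  by rewrite divr_gt0// mulr_gt0.
have ub : `|t k - t l| <= c * N `^ (1 - theta) by rewrite -Ke.
have := disp _ _ _ (x k - x l) N1 nN tkl0 ub.
rewrite -/(wave _ _ _ _) => disp'.
apply: (@le_trans _ _ ((C1 * N * d%:R `^ (- theta^-1)) ^+ 2)).
  rewrite ler_pXn2r ?nnegrE ?normc_ge0 ?mulr_ge0 ?powR_ge0 ?(ltW N0) ?(ltW C0)//.
  apply: le_trans disp' _; rewrite /C1 -!mulrA ler_pM2l//.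
  have -> : N = (N `^ (- theta)) `^ (- theta^-1).
    by rewrite -powRrM mulNr mulrN opprK mulfV ?gt_eqF// powRr1// ltW.
  rewrite -!powRM ?mulr_ge0 ?powR_ge0 ?divr_ge0 ?(ltW c0)//.
  rewrite !powRN lef_pV2 ?posrE ?powR_gt0 ?normr_gt0 ?mulr_gt0 ?invr_gt0 ?powR_gt0//.
  rewrite ge0_ler_powR ?nnegrE ?invr_ge0 ?(ltW th0) ?mulr_ge0 ?invr_ge0 ?powR_ge0 ?(ltW c0)//.
  apply: le_trans f1.
  have -> : N `^ theta = N * N `^ (theta - 1) by rewrite mulr_powRB1// ltW.
  rewrite /e /cell_length -/K (_ : 1 - theta = - (theta - 1)); last by ring.
  rewrite powRN.
  set P := N `^ (theta - 1); have P0 : 0 < P by exact: powR_gt0.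
  rewrite -subr_ge0.
  have -> : d%:R * (c / P / K%:R) / 2 - c / 4 * ((N * P)^-1 * d%:R) =
      c * d%:R / (4 * P * N * K%:R) * (2 * N - K%:R).
    by field; rewrite !gt_eqF.
  by rewrite mulr_ge0 ?subr_ge0// divr_ge0// ?mulr_ge0 ?(ltW P0) ?(ltW N0) ?(ltW c0).
rewrite !exprMn /decay (maxn_idPr d0).
have -> : (d%:R `^ (- theta^-1)) ^+ 2 = d%:R `^ (- (2 / theta)) :> R.
  by rewrite -powR_mulrn ?powR_ge0// -powRrM; congr powR; ring.
by rewrite ler_wpM2r ?powR_ge0// ler_wpM2r ?sqr_ge0// lerDr.
Qed.

End space_time_cells.

(** * Suprema of the density over time cells *)

Section cell_majorant.
Context {R : realType}.
Implicit Types (theta N t x : R) (J : set nat) (f : nat -> R -> R[i]) (nu : nat -> R).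
Local Notation normc := (@Normc.normc R).

Definition intensity theta N J f t x j : R :=
  if `[< J j >] then normc (schrodinger_cutoff theta N t (f j) x) ^+ 2 else 0.

Lemma intensity_ge0 theta N J f t x j : 0 <= intensity theta N J f t x j.
Proof. by rewrite /intensity; case: ifP => // _; exact: sqr_ge0. Qed.

Lemma intensity_wave theta N J f t x j : 0 <= N ->
  intensity theta N J f t x j =
  normc (\sum_(xi <- frequencies (Num.truncn N))
     (if `[< J j >] then fourier_coef (f j) xi else 0) * wave theta t x xi) ^+ 2.
Proof.
move=> N0; rewrite /intensity; case: ifPn => _.
  by rewrite schrodinger_cutoff_wave.
by rewrite big1 ?Normc.normc0 ?expr0n// => xi _; rewrite mul0r.
Qed.

Lemma sum_intensity_le theta N J f t x m : 0 <= N -> orthonormal_system J f ->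
  \sum_(j < m) intensity theta N J f t x j <= (size (frequencies (Num.truncn N)))%:R.
Proof.
move=> N0 fJ; under eq_bigr do rewrite intensity_wave//.
apply: le_trans (bessel_fourier_coef _ (uniq_frequencies _) fJ _) _.
rewrite (eq_bigr (fun=> 1)); last by move=> xi _; rewrite normc_wave expr1n.
by rewrite big_const_seq count_predT iter_addr_0.
Qed.

(** Kept as a partial sum so that the finite matrix estimates apply; they are used uniformly in
    [m]. *)
Definition weighted_intensity theta N J f nu m t x : R :=
  \sum_(j < m) nu j * intensity theta N J f t x j.

Lemma weighted_intensity_ge0 theta N J f nu m t x : (forall j, 0 <= nu j) ->
  0 <= weighted_intensity theta N J f nu m t x.
Proof. by move=> nu0; apply: sumr_ge0 => j _; rewrite mulr_ge0// intensity_ge0. Qed.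

Lemma weighted_intensity_le theta N J f nu m t x : 0 <= N -> orthonormal_system J f ->
  (forall j, 0 <= nu j <= 1) ->
  weighted_intensity theta N J f nu m t x <= (size (frequencies (Num.truncn N)))%:R.
Proof.
move=> N0 fJ nu01; apply: le_trans (@sum_intensity_le theta N J f t x m N0 fJ).
apply: ler_sum => j _; have /andP[_ nu1] := nu01 j.
by rewrite ler_piMl// intensity_ge0.
Qed.

Lemma weighted_intensity_homo theta N J f nu m m' t x : (forall j, 0 <= nu j) ->
  (m <= m')%N ->
  weighted_intensity theta N J f nu m t x <= weighted_intensity theta N J f nu m' t x.
Proof.
move=> nu0 mm; rewrite /weighted_intensity.
by apply: (@ler_sum_ord R m m' (fun j => nu j * intensity theta N J f t x j) mm) => j; rewrite mulr_ge0// intensity_ge0.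
Qed.

Lemma sum_sqr_le1 nu : (forall j, 0 <= nu j) ->
  (forall m, \sum_(j < m) nu j ^+ 2 <= 1) -> forall j, 0 <= nu j <= 1.
Proof.
move=> nu0 snu j; rewrite nu0/= -(@ler_pXn2r R 2) ?nnegrE// expr1n.
apply: le_trans (snu j.+1); rewrite big_ord_recr/= lerDr.
by apply: sumr_ge0 => *; exact: sqr_ge0.
Qed.

(** v_k is the supremum over the times of the k-th cell, all x and all truncations. It is finite by
    Bessel's inequality, and the discrete bound is applied at near-maximisers, one per cell. *)
Lemma cell_majorant theta : 2 < theta ->
  exists C c : R, [/\ 0 < C, 0 < c <= 1 & forall N J f nu t0,
    1 < N -> orthonormal_system J f ->
    (forall j, 0 <= nu j) -> (forall m, \sum_(j < m) nu j ^+ 2 <= 1) ->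
    exists v : nat -> R, [/\ forall k, 0 <= v k,
      forall k t x m, (k < cell_count N)%N ->
        t0 + k%:R * cell_length c theta N <= t <= t0 + k.+1%:R * cell_length c theta N ->
        weighted_intensity theta N J f nu m t x <= v k &
      \sum_(k < cell_count N) v k `^ theta <= C * N `^ theta]].
Proof.
move=> th2; have th0 : 0 < theta by lra.
have [C1 [c [C10 c01 decayP]]] := @wave_kernel_decay R theta th2.
have [C2 C20 density] := @discrete_density_bound R int theta th2.
exists (2 `^ theta * (C2 * C1 `^ (theta / 2))), c; split => //.
  by rewrite !mulr_gt0// powR_gt0.
move=> N J f nu t0 N1 fJ nu0 snu.
have N0 : 0 < N by lra.
have nu01 := sum_sqr_le1 nu0 snu.
set e := cell_length c theta N; set K := cell_count N.
have e0 : 0 < e by case/andP: c01 => c0 _; rewrite !mulr_gt0 ?powR_gt0 ?invr_gt0.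
pose rho := weighted_intensity theta N J f nu.
pose incell k t := t0 + k%:R * e <= t <= t0 + k.+1%:R * e.
pose A k := [set y | exists t x m, incell k t /\ y = rho m t x].
have incell0 k : incell k (t0 + k%:R * e) by rewrite /incell lexx/= lerD2l ler_pM2r// ler_nat.
have A0 k : A k 0.
  by exists (t0 + k%:R * e), 0, 0%N; split => //; rewrite /rho /weighted_intensity big_ord0.
have Aub k : has_ubound (A k).
  exists (size (frequencies (Num.truncn N)))%:R => y [t [x [m [_ ->]]]].
  by apply: weighted_intensity_le => //; exact: ltW.
pose v k := sup (A k).
have v0 k : 0 <= v k by exact: ub_le_sup.
exists v; split => //.
  by move=> k t x m kK tk; apply: ub_le_sup => //; exists t, x, m.
(* The supremum need not be attained, hence the loss of a factor 2, which becomes 2^theta in the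
   constant. *)
have near k : exists p : R * R * nat, incell k p.1.1 /\ v k <= 2 * rho p.2 p.1.1 p.1.2.
  have [vk0|vk0] := eqVneq (v k) 0.
    exists (t0 + k%:R * e, 0, 0%N); split => //=.
    by rewrite vk0 /rho /weighted_intensity big_ord0 mulr0.
  have vkgt : 0 < v k by rewrite lt0r vk0 v0.
  have [|y [t [x [m [tk ->]]]] yv] := @sup_gt R (A k) (v k / 2) (ex_intro _ _ (A0 k)).
    by rewrite ltr_pdivrMr// ltr_pMr// ltr1n.
  by exists (t, x, m); split => //=; move: yv; rewrite ltr_pdivrMr// mulrC => /ltW.
have [g gP] := choice near.
(* The discrete bound needs one truncation for all cells; enlarging it only increases the partial
   sums. *)
pose m := (\max_(k < K) (g k).2)%N.
pose t k := (g k).1.1; pose x k := (g k).1.2.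
have vle k : (k < K)%N -> v k <= 2 * rho m (t k) (x k).
  move=> kK; have [_ h] := gP k; apply: le_trans h _; rewrite ler_pM2l//.
  apply: weighted_intensity_homo => //.
  exact: (@leq_bigmax _ (fun k : 'I_K => (g k).2) (Ordinal kK)).
apply: (@le_trans _ _ (2 `^ theta * \sum_(k < K) rho m (t k) (x k) `^ theta)).
  rewrite mulr_sumr; apply: ler_sum => k _.
  have r0 : 0 <= rho m (t k) (x k) by exact: weighted_intensity_ge0.
  by rewrite -powRM// ge0_ler_powR ?nnegrE ?mulr_ge0 ?(ltW th0)// vle.
rewrite -!mulrA ler_pM2l ?powR_gt0//.
pose E k := wave theta (t k) (x k).
have tcell k : (k < K)%N -> t0 + k%:R * e <= t k <= t0 + k.+1%:R * e.
  by move=> _; have [] := gP k.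
have := density (frequencies (Num.truncn N)) m _ K E (C1 * N ^+ 2) nu
  (bessel_fourier_coef m (uniq_frequencies _) fJ) _ (decayP _ _ _ x N1 tcell) nu0 (snu m).
rewrite mulr_ge0 ?sqr_ge0 ?(ltW C10)// => /(_ isT).
rewrite powRM ?sqr_ge0 ?(ltW C10)//.
have -> : (N ^+ 2) `^ (theta / 2) = N `^ theta.
  by rewrite -powR_mulrn ?(ltW N0)// -powRrM mulrC divfK.
apply: le_trans; rewrite le_eqVlt; apply/orP; left; apply/eqP.
apply: eq_bigr => k _; congr (_ `^ _); apply: eq_bigr => j _.
by rewrite intensity_wave// ltW.
Qed.

End cell_majorant.

(** * Limits of series, Hoelder for sums, comparison of integrals *)

Section series_and_integral_bounds.
Context {R : realType}.
Local Notation normc := (@Normc.normc R).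

(** A [limn] carries information only once convergence is known. Here both components converge
    absolutely, and the bound on squared moduli passes to the limit. *)
Lemma normc_cseries_le (u : nat -> R[i]) (b : R) :
  (forall m, \sum_(j < m) normc (u j) <= b) -> normc (cseries u) <= b.
Proof.
move=> ub; have b0 : 0 <= b by have := ub 0%N; rewrite big_ord0.
have cvgr (g : nat -> R) : (forall j, `|g j| <= normc (u j)) -> cvgn (series g).
  move=> gu; apply: normed_cvg; apply: nondecreasing_is_cvgn.
    by apply: nondecreasing_series => *; rewrite normr_ge0.
  exists b => _ [m _ <-]; apply: le_trans (ub m).
  by rewrite /= /series/= big_mkord; apply: ler_sum.
have cRe := cvgr _ (fun j => ler_norm_Re (u j)).
have cIm := cvgr _ (fun j => ler_norm_Im (u j)).
rewrite -(@ler_pXn2r R 2) ?nnegrE ?normc_ge0// sqr_normc/=.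
rewrite !expr2.
have c2 : (series (fun j => complex.Re (u j)) n * series (fun j => complex.Re (u j)) n +
    series (fun j => complex.Im (u j)) n * series (fun j => complex.Im (u j)) n) @[n --> \oo]
  --> limn (series (fun j => complex.Re (u j))) * limn (series (fun j => complex.Re (u j))) +
      limn (series (fun j => complex.Im (u j))) * limn (series (fun j => complex.Im (u j))).
  by apply: cvgD; apply: cvgM.
rewrite -(cvg_lim _ c2)//; apply: limr_le; first by apply/cvg_ex; eexists; exact: c2.
apply: nearW => n; rewrite -!expr2.
have -> : series (fun j => complex.Re (u j)) n = complex.Re (\sum_(j < n) u j).
  rewrite /series/= big_mkord; elim/big_rec2: _ => // i x y _ ->.
  by rewrite ReD.
have -> : series (fun j => complex.Im (u j)) n = complex.Im (\sum_(j < n) u j).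
  rewrite /series/= big_mkord; elim/big_rec2: _ => // i x y _ ->.
  by rewrite ImD.
rewrite -sqr_normc ler_pXn2r ?nnegrE ?normc_ge0//.
exact: le_trans (ler_normc_sum _ _ _) (ub n).
Qed.

(** Young's inequality termwise after dividing by the two totals, with exponents 1/(1-s) and 1/s.
    The ends s = 0 and s = 1 and zero totals are separated because these quotients degenerate. *)
Lemma hoelder_sum (m : nat) (a b : nat -> R) (s : R) : 0 <= s <= 1 ->
  (forall j, 0 <= a j) -> (forall j, 0 <= b j) ->
  \sum_(j < m) a j `^ (1 - s) * b j `^ s <=
  (\sum_(j < m) a j) `^ (1 - s) * (\sum_(j < m) b j) `^ s.
Proof.
move=> /andP[s0 s1] a0 b0.
have [->|sN0] := eqVneq s 0.
  rewrite subr0 powRr0 mulr1 powRr1 ?sumr_ge0//; apply: ler_sum => j _.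
  by rewrite powRr0 mulr1 powRr1.
have [->|sN1] := eqVneq s 1.
  rewrite subrr powRr0 mul1r powRr1 ?sumr_ge0//; apply: ler_sum => j _.
  by rewrite powRr0 mul1r powRr1.
have sgt0 : 0 < s by rewrite lt0r sN0.
have slt1 : s < 1 by rewrite lt_neqAle sN1.
have s1' : 0 < 1 - s by rewrite subr_gt0.
set A := \sum_(j < m) a j; set B := \sum_(j < m) b j.
have A0 : 0 <= A by exact: sumr_ge0.
have B0 : 0 <= B by exact: sumr_ge0.
have [AE|AN0] := eqVneq A 0.
  rewrite big1 ?mulr_ge0 ?powR_ge0// => j _.
  have a0' := @psumr_eq0P _ _ xpredT (fun j : 'I_m => a j) (fun j _ => a0 j) AE j isT.
  by rewrite a0' powR0 ?mul0r// gt_eqF.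
have [BE|BN0] := eqVneq B 0.
  rewrite big1 ?mulr_ge0 ?powR_ge0// => j _.
  have b0' := @psumr_eq0P _ _ xpredT (fun j : 'I_m => b j) (fun j _ => b0 j) BE j isT.
  by rewrite b0' [X in _ * X]powR0 ?mulr0.
have Agt0 : 0 < A by rewrite lt0r AN0.
have Bgt0 : 0 < B by rewrite lt0r BN0.
have termwise j : a j `^ (1 - s) * b j `^ s <=
    A `^ (1 - s) * B `^ s * ((1 - s) * (a j / A) + s * (b j / B)).
  have aA : 0 <= a j / A by rewrite divr_ge0.
  have bB : 0 <= b j / B by rewrite divr_ge0.
  have := @conjugate_powR R ((a j / A) `^ (1 - s)) ((b j / B) `^ s) (1 - s)^-1 s^-1
    (powR_ge0 _ _) (powR_ge0 _ _).
  rewrite !invr_gt0 !invrK subrK => /(_ s1' sgt0 erefl).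
  rewrite -!powRrM mulfV ?gt_eqF// mulfV// !powRr1// => h.
  have -> : a j `^ (1 - s) * b j `^ s = A `^ (1 - s) * B `^ s * ((a j / A) `^ (1 - s) * (b j / B) `^ s).
    by rewrite mulrACA -!powRM// !(mulrC _ (_ / _)) !divfK.
  by rewrite ler_pM2l ?mulr_gt0 ?powR_gt0// (mulrC (1 - s)) (mulrC s).
apply: le_trans (ler_sum _ (fun (j : 'I_m) _ => termwise j)) _.
rewrite -mulr_sumr big_split/= -!mulr_sumr -!mulr_suml -/A -/B !divff// !mulr1 subrK.
by rewrite mulr1.
Qed.

(* No measurability is required: the integral of a nonnegative function is a
   supremum over the simple functions below it. *)
Lemma le_integral_mrestr d (T : measurableType d) (mu : {measure set T -> \bar R})
    (D : set T) (mD : measurable D) (f g : T -> \bar R) :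
  (forall x, 0 <= f x)%E -> (forall x, D x -> f x <= g x)%E ->
  (\int[mrestr mu mD]_x f x <= \int[mu]_(x in D) g x)%E.
Proof.
move=> f0 fg; rewrite ge0_integralTE// ge0_integralE; last first.
  by move=> x Dx; exact: le_trans (f0 x) (fg x Dx).
apply: ge_ereal_sup => _ [h hf <-].
apply: ereal_sup_ubound; exists (proj_nnsfun h mD).
  move=> x; rewrite -mrestrict /patch; case: ifPn => xD; last by [].
  by apply: le_trans (hf x) _; apply: fg; rewrite inE in xD.
rewrite -mrestrict /sintegral; apply: eq_fsbigr => y _.
(* Cutting [h] off outside D may alter the level set at 0, whose contribution vanishes anyway. *)
have [->|y0] := eqVneq y 0; first by rewrite !mul0e.
congr (_ * mu _)%E; apply/seteqP; split => x /=; rewrite /patch.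
  case: ifPn => xD E; first by rewrite inE in xD.
  by move: y0; rewrite -E => /eqP[].
by move=> [E Dx]; rewrite mem_set.
Qed.

End series_and_integral_bounds.

(** * The norm in x at a fixed time *)

Section spatial_norm.
Context {R : realType}.
Implicit Types (theta N t x : R) (J : set nat) (f : nat -> R -> R[i]).
Local Notation normc := (@Normc.normc R).
Local Notation mu := (@lebesgue_measure R).
Local Notation D := [set` @torus R].

Lemma normc_density_le theta N J (lam : nat -> R[i]) f t x (w : nat -> R) (L b : R) :
  0 <= L -> (forall j, J j -> normc (lam j) = L * w j) ->
  (forall m, weighted_intensity theta N J f w m t x <= b) ->
  normc (density theta N J lam f t x) <= L * b.
Proof.
move=> L0 lamE wb; apply: normc_cseries_le => m.
apply: le_trans (ler_wpM2l L0 (wb m)).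
rewrite /weighted_intensity mulr_sumr; apply: ler_sum => j _.
rewrite /intensity; case: ifPn => [/asboolP Jj|_]; last by rewrite Normc.normc0 !mulr0.
rewrite Normc.normcM lamE// mulrA ler_wpM2l//.
  by rewrite -lamE// normc_ge0.
set z := schrodinger_cutoff _ _ _ _ _.
rewrite (_ : `|z| ^+ 2 = (normc z ^+ 2)%:C%C); last by rewrite rmorphXn.
by rewrite normc_real// sqr_ge0.
Qed.

Lemma measurable_intensity theta N J f t j : 0 <= N ->
  measurable_fun D (fun x => intensity theta N J f t x j).
Proof.
move=> N0; rewrite /intensity; case: (`[< J j >]); last exact: measurable_cst.
have E : schrodinger_cutoff theta N t (f j) = trig_poly (frequencies (Num.truncn N))
    (fun xi => schrodinger_symbol theta t xi * fourier_coef (f j) xi).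
  by apply/funext => x; rewrite schrodinger_cutoffE.
apply: measurable_sqr_normc; rewrite E.
by case: (sqintegrable_trig_poly (frequencies (Num.truncn N))
  (fun xi => schrodinger_symbol theta t xi * fourier_coef (f j) xi)).
Qed.

(** The propagator symbol has modulus 1, so Parseval leaves the squared norm of one row of a Bessel
    system. *)
Lemma integral_intensity_le1 theta N J f t j : 0 <= N -> orthonormal_system J f ->
  (\int[mu]_(x in D) (intensity theta N J f t x j)%:E <= 1)%E.
Proof.
move=> N0 fJ; rewrite /intensity; case: (boolP (`[< J j >])) => Jj; last by rewrite integral0.
have us := uniq_frequencies (Num.truncn N).
under eq_integral do rewrite schrodinger_cutoffE//.
rewrite integral_trig_poly// lee_fin.
have := bessel_norm_le1 (bessel_fourier_coef j.+1 us fJ) (ltnSn j).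
apply: le_trans; apply: ler_sum => xi _.
by rewrite Normc.normcM normc_cexp mul1r Jj.
Qed.

(** This is the interpolation step. For finite q, pointwise Hoelder leaves the factor v^(1-1/q),
    bounded uniformly in x, times T^(1/q), where the integral of T is at most sum_j w_j^alpha <= 1.
    For q = oo the exponent alpha/2 is 1 and the hypothesis on v applies directly. *)
Lemma spatial_norm_le theta N J (lam : nat -> R[i]) f t (w : nat -> R) (L v : R) (q : \bar R) :
  0 <= N -> orthonormal_system J f -> (1 <= q)%E -> 0 <= L -> 0 <= v ->
  (forall j, 0 <= w j) -> (forall j, J j -> normc (lam j) = L * w j) ->
  (forall m, \sum_(j < m) w j `^ alpha_max q <= 1) ->
  (forall m x, weighted_intensity theta N J f (fun j => w j `^ (alpha_max q / 2)) m t x <= v) ->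
  (Lnorm (lebesgue_on torus) q (fun x => (normc (density theta N J lam f t x))%:E)
    <= (L * v `^ (1 - fine q^-1))%:E)%E.
Proof.
move=> N0 fJ q1 L0 v0 w0 lamE sw wv.
case: q q1 sw wv => [r| |]// q1 sw wv; last first.
  rewrite unlock invey/= subr0 powRr1//; case: ifPn => _; last by rewrite lee_fin mulr_ge0.
  apply/ess_supP; apply: nearW => x /=; rewrite lee_fin ger0_norm ?normc_ge0//.
  apply: normc_density_le lamE _ => // m; apply: le_trans (wv m x).
  by apply: ler_sum => j _; rewrite /alpha_max divff// powRr1.
rewrite lee_fin in q1.
have r0 : 0 < r by exact: lt_le_trans q1.
rewrite inver gt_eqF//=.
pose am := alpha_max r%:E; rewrite -/am in sw wv.
have amE : am = 2 * r / (r + 1) by [].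
have am0 : 0 < am by rewrite amE divr_gt0 ?mulr_gt0 ?addr_gt0.
pose s := 1 - r^-1.
have s01 : 0 <= s <= 1.
  by rewrite /s subr_ge0 invf_le1// q1/= gerBl invr_ge0 ltW.
pose a j := w j `^ am; pose b j := w j `^ (am / 2).
have a0 j : 0 <= a j by exact: powR_ge0.
pose P x j := intensity theta N J f t x j.
have P0 x j : 0 <= P x j by exact: intensity_ge0.
have a01 j : 0 <= a j <= 1.
  rewrite a0/=; apply: le_trans (sw j.+1); rewrite big_ord_recr/= lerDr.
  by apply: sumr_ge0 => *; exact: powR_ge0.
(* The full series serves as one measurable majorant for all truncations; Bessel makes it finite at
   every point. *)
pose T x := (\sum_(j <oo) (a j * P x j)%:E)%E.
have aP0 x j : (0 <= (a j * P x j)%:E)%E by rewrite lee_fin mulr_ge0.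
have partialT x m : ((\sum_(j < m) a j * P x j)%:E <= T x)%E.
  rewrite -sumEFin -(big_mkord xpredT (fun j => (a j * P x j)%:E)).
  exact: nneseries_lim_ge.
have T0 x : (0 <= T x)%E by exact: nneseries_ge0.
have Tfin x : T x \is a fin_num.
  rewrite ge0_fin_numE//; apply: (@le_lt_trans _ _ (size (frequencies (Num.truncn N)))%:R%:E); last exact: ltry.
  apply: lime_le; first exact: is_cvg_nneseries.
  apply: nearW => m; rewrite big_mkord sumEFin lee_fin.
  exact: (@weighted_intensity_le R theta N J f a m t x N0 fJ a01).
(* The weights match only if am/q + (am/2)(1 - 1/q) = 1, which is the origin of the exponent
   2q/(q+1). *)
have wE j x : w j * P x j = (a j * P x j) `^ (1 - s) * (b j * P x j) `^ s.
  rewrite !powRM ?powR_ge0// mulrACA -[X in _ = _ * X]powRD; last by rewrite subrK oner_eq0.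
  rewrite subrK powRr1// /a /b -!powRrM -powRD.
    have -> : am * (1 - s) + am / 2 * s = 1.
      by rewrite amE /s; field; rewrite !gt_eqF// ltr_wpDr.
    by rewrite powRr1.
  have -> : am * (1 - s) + am / 2 * s = 1.
    by rewrite amE /s; field; rewrite !gt_eqF// ltr_wpDr.
  by rewrite oner_eq0.
have densle x : normc (density theta N J lam f t x) <= L * (fine (T x) `^ r^-1 * v `^ s).
  apply: normc_density_le lamE _ => // m.
  rewrite /weighted_intensity (eq_bigr (fun j : 'I_m => (a j * P x j) `^ (1 - s) * (b j * P x j) `^ s)); last first.
    by move=> j _; exact: wE.
  apply: le_trans (@hoelder_sum _ m (fun j => a j * P x j) (fun j => b j * P x j) s s01 _ _) _.
  - by move=> j; rewrite mulr_ge0.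
  - by move=> j; rewrite mulr_ge0 ?powR_ge0.
  rewrite (_ : 1 - s = r^-1); last by rewrite /s opprB addrC subrK.
  have [s0 _] := andP s01.
  rewrite ler_pM ?powR_ge0// ge0_ler_powR ?nnegrE ?invr_ge0 ?(ltW r0) ?fine_ge0 ?sumr_ge0//.
  - by move=> j _; rewrite mulr_ge0.
  - by rewrite -lee_fin fineK.
  - by move=> j _; rewrite mulr_ge0 ?powR_ge0.
  - exact: wv.
pose c := L `^ r * v `^ (r * s).
have c0 : 0 <= c by rewrite mulr_ge0 ?powR_ge0.
rewrite unlock.
have -> : (L * v `^ (1 - r^-1))%:E = (c%:E `^ r^-1)%E.
  rewrite poweR_EFin /c powRM ?powR_ge0// -!powRrM mulfV ?gt_eqF// powRr1//.
  by rewrite mulrAC mulfV ?gt_eqF// mul1r.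
apply: gt0_ler_poweR.
- by rewrite invr_ge0 ltW.
- rewrite in_itv; apply/andP; split; last exact: leey.
  by apply: integral_ge0 => x _; exact: poweR_ge0.
- by rewrite in_itv/= lee_fin c0 leey.
apply: (@le_trans _ _ (\int[mu]_(x in D) (c%:E * T x))%E).
  apply: le_integral_mrestr; first by move=> x; exact: poweR_ge0.
  move=> x _; rewrite abse_EFin poweR_EFin -(fineK (Tfin x)) -EFinM lee_fin.
  rewrite ger0_norm ?normc_ge0//.
  apply: (@le_trans _ _ ((L * (fine (T x) `^ r^-1 * v `^ s)) `^ r)).
    by rewrite ge0_ler_powR ?nnegrE ?normc_ge0 ?(ltW r0) ?mulr_ge0 ?powR_ge0// densle.
  rewrite !powRM ?mulr_ge0 ?powR_ge0// -!powRrM mulVf ?gt_eqF// powRr1 ?fine_ge0//.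
  by rewrite /c (mulrC s r) [fine _ * _]mulrC mulrA.
have mT j : measurable_fun D (fun x => (a j * P x j)%:E).
  apply/measurable_EFinP; apply: measurable_funM; first exact: measurable_cst.
  exact: measurable_intensity.
have mD : measurable (D : set (measurableTypeR R)) by exact: measurable_itv.
have mTT : measurable_fun D T by apply: ge0_emeasurable_sum => // *; exact: aP0.
rewrite ge0_integralZl// /T integral_nneseries//.
rewrite -[leRHS]mule1 lee_wpmul2l//.
apply: (@le_trans _ _ (\sum_(j <oo) (a j)%:E)%E).
  apply: lee_nneseries => j _.
    by move=> _; apply: integral_ge0 => x _; exact: aP0.
  under eq_integral do rewrite EFinM.
  have mP : measurable_fun D (fun x => (P x j)%:E).
    by apply/measurable_EFinP; exact: measurable_intensity.
  rewrite ge0_integralZl_EFin//; last by move=> x _; rewrite lee_fin.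
  rewrite -[leRHS]mule1 lee_wpmul2l ?lee_fin//.
  exact: integral_intensity_le1.
apply: lime_le; first by apply: is_cvg_nneseries => *; rewrite lee_fin.
by apply: nearW => m; rewrite big_mkord sumEFin lee_fin.
Qed.

End spatial_norm.

(** * Integration in time and normalisation of the coefficients *)

Section space_time_norm.
Context {R : realType}.
Implicit Types (theta N t x : R) (J : set nat) (f : nat -> R -> R[i]).
Local Notation normc := (@Normc.normc R).
Local Notation mu := (@lebesgue_measure R).

Lemma interval_enclosure (I : interval R) (L : R) : mu [set` I] = L%:E ->
  0 <= L /\ exists a, forall t, t \in I -> a <= t <= a + L.
Proof.
move=> IL; have L0 : 0 <= L by rewrite -lee_fin -IL measure_ge0.
have mem b1 b2 x y t : t \in Interval (BSide b1 x) (BSide b2 y) -> x <= t <= y.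
  by rewrite itv_boundlr; case: b1 b2 => [] []; rewrite !bnd_simp => /andP[h1 h2];
    apply/andP; split => //; exact: ltW.
split => //; move: IL; rewrite lebesgue_measure_itv.
case: I => [[b1 x|[|]] [b2 y|[|]]] /=.
- rewrite lte_fin; have [xy [LE]|yx _] := ltP x y; exists x => t /mem/andP[xt ty].
    by rewrite xt/= -LE; lra.
  by rewrite xt (le_trans ty)// (le_trans yx)// lerDl.
(* Rays have infinite measure, against [IL]; a left end +oo or a right end -oo leaves an empty
   interval. *)
all: try by rewrite ?ltNyr ?ltry//.
all: try by move=> _; exists 0 => t; rewrite itv_boundlr ?bnd_simp ?andbF.
Qed.

(** On I the integrand lies below the step function sum_i c_i 1_(cell i). Cells may overlap or leave
    I, which only enlarges the bound. *)
Lemma integral_cells_le (T : finType) (I : interval R) (F : R -> \bar R) (lo c : T -> R) (e : R) :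
  0 <= e -> (forall t, 0 <= F t)%E -> (forall i, 0 <= c i) ->
  (forall t, t \in I -> exists2 i, lo i <= t <= lo i + e & (F t <= (c i)%:E)%E) ->
  (\int[lebesgue_on I]_t F t <= (e * \sum_i c i)%:E)%E.
Proof.
move=> e0 F0 c0 cover.
pose cell i : set (measurableTypeR R) := `[lo i, lo i + e]%classic.
have mcell i : measurable (cell i) by exact: measurable_itv.
have mI : measurable ([set` I] : set (measurableTypeR R)) by exact: measurable_itv.
have cellE i : mu (cell i) = e%:E.
  rewrite lebesgue_measure_itv/= lte_fin ltrDl; case: ltP => h.
    by rewrite -EFinD addrAC subrr add0r.
  by congr EFin; apply/eqP; rewrite eq_le h e0.
apply: (@le_trans _ _ (\int[mu]_(t in [set` I]) (\sum_(i <- index_enum T) (c i)%:E * (\1_(cell i) t)%:E))%E).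
  apply: le_integral_mrestr => // t tI; have [i ti Fi] := cover t tI.
  apply: le_trans Fi _; rewrite (bigD1 i)//=.
  rewrite indicE mem_set ?mule1; last by rewrite /cell/= in_itv.
  by rewrite leeDl// sume_ge0// => j _; rewrite mule_ge0 ?lee_fin.
have mindic i : measurable_fun [set` I] (fun t => (\1_(cell i) t)%:E : \bar R).
  by apply/measurable_EFinP; exact: (@measurable_indic _ (measurableTypeR R) R [set` I] (cell i) (mcell i)).
have mc i : measurable_fun [set` I] (fun t => (c i)%:E * (\1_(cell i) t)%:E)%E.
  apply: measurable_funeM; exact: mindic.
rewrite ge0_integral_sum//; last first.
  by move=> i t _; rewrite mule_ge0 ?lee_fin.
rewrite mulr_sumr -sumEFin; apply: lee_sum => i _.
rewrite ge0_integralZl_EFin//; last exact: mindic.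
rewrite integral_indic// mulrC EFinM lee_wpmul2l ?lee_fin// -(cellE i).
by apply: le_measure; rewrite ?inE//; exact: measurableI.
Qed.

(** Dividing by the norm gives sum_j w_j^alpha <= 1, hence w_j <= 1 and w_j^am <= w_j^alpha. So
    every admissible exponent reduces to the largest one, without loss in the constant. *)
Lemma ell_norm_normalization (alpha am : R) (J : set nat) (lam : nat -> R[i]) :
  1 <= alpha <= am -> (ell_norm alpha J lam < +oo)%E ->
  exists2 L : R, 0 <= L & ell_norm alpha J lam = L%:E /\
  exists w : nat -> R, [/\ forall j, 0 <= w j, forall j, J j -> normc (lam j) = L * w j &
    forall m, \sum_(j < m) w j `^ am <= 1].
Proof.
move=> /andP[a1 aam] ellfin.
have a0 : 0 < alpha by exact: lt_le_trans a1.
have am0 : 0 < am by exact: lt_le_trans aam.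
pose u j := (normc (lam j) `^ alpha)%:E.
have u0 j : (0 <= u j)%E by rewrite lee_fin powR_ge0.
set S := (\esum_(j in J) u j)%E.
have S0 : (0 <= S)%E by apply: esum_ge0 => j _; exact: u0.
have Sfin : S \is a fin_num.
  rewrite ge0_fin_numE//; apply: lty_poweRy ellfin.
  by rewrite invr_eq0 gt_eqF.
pose s := fine S; have SE : S = s%:E by rewrite fineK.
have s0 : 0 <= s by exact: fine_ge0.
have partialS m : \sum_(j < m) (if `[< J j >] then normc (lam j) `^ alpha else 0) <= s.
  rewrite -lee_fin -SE /S.
  have -> : J = [set j | `[< J j >]] by apply/seteqP; split => j /=; rewrite asboolE.
  rewrite -nneseries_esum// -sumEFin.
  apply: le_trans (@nneseries_lim_ge R u (fun j => `[< J j >]) 0%N m _); last by [].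
  rewrite big_mkord [leRHS]big_mkcond/=; apply: lee_sum => j _.
  by rewrite asboolE; case: ifP.
pose L := s `^ alpha^-1; have L0 : 0 <= L by exact: powR_ge0.
exists L => //; split; first by rewrite /ell_norm -/S SE poweR_EFin.
pose w j := if `[< J j >] then normc (lam j) / L else 0.
have w0 j : 0 <= w j by rewrite /w; case: ifP => // _; rewrite divr_ge0 ?normc_ge0.
have LA : L `^ alpha = s by rewrite /L -powRrM mulVf ?gt_eqF// powRr1.
have sw m : \sum_(j < m) w j `^ alpha <= 1.
  have [s00|sN0] := eqVneq s 0.
    rewrite big1// => j _; rewrite /w /L s00 powR0 ?invr_eq0 ?gt_eqF// invr0 mulr0.
    by case: ifP; rewrite powR0// gt_eqF.
  have sgt : 0 < s by rewrite lt0r sN0.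
  have wE j : w j `^ alpha = (if `[< J j >] then normc (lam j) `^ alpha else 0) / s.
    rewrite /w; case: ifP => _; last by rewrite mul0r powR0// gt_eqF.
    rewrite powRM ?normc_ge0 ?invr_ge0//; congr (_ * _).
    by rewrite -[L^-1]powR_inv1// powRAC LA powR_inv1.
  by under eq_bigr do rewrite wE; rewrite -mulr_suml ler_pdivrMr// mul1r.
exists w; split => //.
- move=> j Jj; rewrite /w asboolT//.
  (* If the norm is 0, division by zero makes [w] vanish, and the factorisation holds because every
     coefficient indexed by J vanishes too. *)
  have [L00|LN0] := eqVneq L 0; last by rewrite mulrC divfK.
  have s00 : s = 0 by rewrite -LA L00 powR0// gt_eqF.
  rewrite L00 mul0r; apply: (@powR_eq0_eq0 _ _ alpha); apply/eqP.
  rewrite eq_le powR_ge0 andbT -s00; apply: le_trans (partialS j.+1).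
  rewrite big_ord_recr/= asboolT// lerDr; apply: sumr_ge0 => i _.
  by case: ifP => // _; exact: powR_ge0.
- move=> m; apply: le_trans (sw m); apply: ler_sum => j _.
  have [wj0|wjN0] := eqVneq (w j) 0; first by rewrite wj0 !powR0// gt_eqF.
  have wj : 0 < w j by rewrite lt0r wjN0 w0.
  rewrite ger_powR// wj/= leNgt; apply/negP => w1.
  have := le1r_powR (ltW w1) a1; apply/negP; rewrite -ltNge.
  apply: le_lt_trans w1; apply: le_trans (sw m); rewrite (bigD1 j)//= lerDl.
  by apply: sumr_ge0 => i _; exact: powR_ge0.
Qed.

End space_time_norm.

Theorem theorem1p6 (R : realType) (theta L : R) (htheta : 2 < theta) :
  exists C : R,
    forall (I : interval R) (p q : \bar R) (alpha : R),
      bounded_set [set` I] ->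
      lebesgue_measure [set` I] = L%:E ->
      (1 <= p)%E -> (1 <= q)%E ->
      (theta%:E * p^-1 + q^-1 = 1)%E ->
      1 <= alpha <= alpha_max q ->
    forall (N : R) (J : set nat) (f : nat -> R -> R[i]) (lambda : nat -> R[i]),
      1 < N ->
      orthonormal_system J f ->
      (ell_norm alpha J lambda < +oo)%E ->
      (mixed_norm p q I (density theta N J lambda f)
        <= (C * N `^ ((theta - 1) * fine p^-1))%:E * ell_norm alpha J lambda)%E.
Proof.
have th0 : 0 < theta by lra.
have [C0 [c [C00 c01 majorant]]] := @cell_majorant R theta htheta.
have [c0 c1] := andP c01.
(* Being at least 1, C bounds its own root C^(1/p) for every finite p, and it covers p = oo, where
   the constant 1 suffices. *)
pose C := Num.max 1 ((L + 1) * C0).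
have C1 : 1 <= C by rewrite le_max lexx.
exists C => I p q alpha _ IL p1 q1 pq alphaP N J f lam N1 fJ ellfin.
have N0 : 0 < N by lra.
have [L0 [a Ia]] := interval_enclosure IL.
set am := alpha_max q in alphaP.
have [Lam Lam0 [ellE [w [w0 lamE sw]]]] := ell_norm_normalization alphaP ellfin.
rewrite ellE -EFinM.
pose nu j := w j `^ (am / 2).
have nu0 j : 0 <= nu j by exact: powR_ge0.
have snu m : \sum_(j < m) nu j ^+ 2 <= 1.
  apply: le_trans (sw m); apply: ler_sum => j _.
  by rewrite /nu -powR_mulrn ?powR_ge0// -powRrM divfK.
pose G t := Lnorm (lebesgue_on torus) q (fun x => (Normc.normc (density theta N J lam f t x))%:E).
have inner t v : 0 <= v ->
    (forall m x, weighted_intensity theta N J f nu m t x <= v) ->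
    (G t <= (Lam * v `^ (1 - fine q^-1))%:E)%E.
  by move=> v0 nuv; apply: spatial_norm_le w0 lamE sw nuv => //; exact: ltW.
have G0 t : (0 <= G t)%E by exact: Lnorm_ge0.
rewrite (_ : mixed_norm p q I _ = Lnorm (lebesgue_on I) p G)//.
clearbody G.
case: p p1 pq => [r| |]// p1 pq; last first.
  (* Here q = 1, so v enters with exponent 0 and the crude Bessel bound for it costs nothing. *)
  have qE : fine q^-1 = 1.
    by move: pq; rewrite invey mule0 add0e => ->.
  rewrite invey/= mulr0 powRr0 mulr1 unlock.
  case: ifPn => _; last by rewrite lee_fin mulr_ge0// (le_trans ler01).
  apply/ess_supP; apply: nearW => t /=; rewrite gee0_abs//.
  apply: le_trans (inner t (size (frequencies (Num.truncn N)))%:R _ _) _ => //.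
    move=> m x; apply: weighted_intensity_le => //; first exact: ltW.
    exact: sum_sqr_le1.
  by rewrite qE subrr powRr0 mulr1 lee_fin ler_peMl.
rewrite lee_fin in p1.
have r0 : 0 < r by exact: lt_le_trans p1.
have rE : (r%:E^-1 = (r^-1)%:E)%E by rewrite inver gt_eqF.
(* The scaling relation enters here: raised to the power r, the spatial bound becomes v^theta, the
   quantity that [majorant] sums. *)
have sE : 1 - fine q^-1 = theta / r.
  move: pq q1; rewrite rE; clear; case: q => [x| |]// + q1.
    rewrite lee_fin in q1; rewrite inver gt_eqF ?(lt_le_trans ltr01)//= -EFinM -EFinD => -[<-].
    by rewrite addrK.
  by rewrite invey adde0 /= => -[<-]; rewrite subr0.
rewrite rE/=.
set K := cell_count N; set e := cell_length c theta N.
have /andP[NK K2] := cell_count_bounds N1; rewrite -/K in NK K2.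
have K0 : 0 < K%:R :> R by rewrite ltr0n.
pose tau := c * N `^ (1 - theta).
have tau0 : 0 < tau by rewrite mulr_gt0// powR_gt0.
have e0 : 0 < e by rewrite divr_gt0.
have Ke : K%:R * e = tau by rewrite /e /cell_length mulrC divfK// gt_eqF.
(* The extra block covers the remainder and the right end of the interval. *)
pose B := (Num.truncn (L / tau)).+1.
have Lt0 : 0 <= L / tau by rewrite divr_ge0// ltW.
have /andP[BL LB] := truncn_itv Lt0.
have exv b := majorant N J f nu (a + b%:R * tau) N1 fJ nu0 snu.
have [v vP] := choice exv.
have v0 b k : 0 <= v b k by have [h _ _] := vP b.
pose T := ('I_B * 'I_K)%type.
have cover t : t \in I -> exists2 i : T,
    a + i.1%:R * tau + i.2%:R * e <= t <= a + i.1%:R * tau + i.2%:R * e + e &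
    (`|G t| `^ r
      <= (Lam `^ r * v i.1 i.2 `^ theta)%:E)%E.
  move=> tI; have /andP[ta tL] := Ia t tI.
  have x0 : 0 <= (t - a) / tau by rewrite divr_ge0 ?subr_ge0// ltW.
  pose b := Num.truncn ((t - a) / tau).
  have /andP[bx xb] := truncn_itv x0; rewrite -/b in bx xb.
  have bB : (b < B)%N.
    rewrite -(ltr_nat R); apply: le_lt_trans LB; apply: le_trans bx _.
    by rewrite ler_pM2r ?invr_gt0// lerBlDl.
  have y0 : 0 <= (t - a - b%:R * tau) / e.
    by rewrite divr_ge0 ?(ltW e0)// subr_ge0 -ler_pdivlMr.
  pose k := Num.truncn ((t - a - b%:R * tau) / e).
  have /andP[ky yk] := truncn_itv y0; rewrite -/k in ky yk.
  have kK : (k < K)%N.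
    rewrite -(ltr_nat R); apply: le_lt_trans ky _.
    rewrite ltr_pdivrMr// Ke ltrBlDr.
    by move: xb; rewrite ltr_pdivrMr// -addn1 natrD; clear; lra.
  rewrite ler_pdivlMr// in ky; rewrite ltr_pdivrMr// -addn1 natrD in yk.
  have tcell : a + b%:R * tau + k%:R * e <= t <= a + b%:R * tau + k.+1%:R * e.
    by rewrite -[k.+1]addn1 natrD; apply/andP; split; move: ky yk; clear; lra.
  exists (Ordinal bB, Ordinal kK) => /=.
    by move: tcell; rewrite -[k.+1]addn1 natrD mulrDl mul1r addrA.
  rewrite gee0_abs//.
  have [_ vt _] := vP b.
  have := inner t (v b k) (v0 b k) (fun m x => vt k t x m kK tcell).
  rewrite sE => h.
  have -> : Lam `^ r * v b k `^ theta = (Lam * v b k `^ (theta / r)) `^ r.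
    by rewrite powRM ?powR_ge0// -powRrM divfK// gt_eqF.
  rewrite -poweR_EFin; apply: gt0_ler_poweR => //.
  - exact: ltW.
  - by rewrite in_itv; apply/andP; split; [exact: G0|exact: leey].
  - by rewrite in_itv/= leey andbT lee_fin mulr_ge0 ?powR_ge0.
have main : (\int[lebesgue_on I]_t
    (`|G t| `^ r)
    <= (Lam `^ r * (C * N `^ (theta - 1)))%:E)%E.
  apply: le_trans (@integral_cells_le R T I _ (fun i => a + i.1%:R * tau + i.2%:R * e)
    (fun i => Lam `^ r * v i.1 i.2 `^ theta) e (ltW e0) _ _ cover) _.
  - by move=> t; exact: poweR_ge0.
  - by move=> i; rewrite mulr_ge0 ?powR_ge0.
  rewrite lee_fin -mulr_sumr mulrCA ler_wpM2l ?powR_ge0//.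
  rewrite -(pair_big xpredT xpredT (fun (b : 'I_B) (k : 'I_K) => v b k `^ theta))/=.
  apply: (@le_trans _ _ (e * (B%:R * (C0 * N `^ theta)))).
    rewrite ler_wpM2l ?(ltW e0)//.
    rewrite (_ : B%:R * _ = \sum_(b < B) C0 * N `^ theta); last first.
      by rewrite sumr_const card_ord mulr_natl.
    by apply: ler_sum => b _; have [] := vP b.
  (* Blocks overshoot I by at most tau <= 1, hence L + 1; the factor 1/N is the ratio of cell to
     block. Against the block bound N^theta this leaves N^(theta-1). *)
  have eB : e * B%:R <= (L + 1) / N.
    rewrite ler_pdivlMr//.
    have tau1 : tau <= 1.
      rewrite /tau -[leRHS]mulr1 ler_pM ?powR_ge0 ?(ltW c0)//.
      by rewrite -[leRHS](powRr0 N) ler_powR ?(ltW N1)//; lra.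
    have h1 : B%:R * tau <= L + tau.
      rewrite /B -addn1 natrD mulrDl mul1r lerD2r.
      by rewrite -ler_pdivlMr.
    have h2 : e * N <= tau by rewrite -Ke mulrC ler_pM2r.
    have h3 : B%:R * (e * N) <= B%:R * tau by rewrite ler_wpM2l.
    move: h1 h3 tau1; clear; lra.
  have NE : N `^ theta = N * N `^ (theta - 1) by rewrite mulr_powRB1// ltW.
  have X0 : 0 <= C0 * N `^ (theta - 1) by rewrite mulr_ge0 ?powR_ge0// ltW.
  apply: (@le_trans _ _ ((L + 1) / N * (C0 * N `^ theta))).
    by rewrite mulrA ler_wpM2r// mulr_ge0 ?powR_ge0// ltW.
  rewrite NE (_ : _ * (C0 * (N * _)) = (L + 1) * C0 * N `^ (theta - 1)); last first.
    by field; rewrite gt_eqF.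
  by rewrite ler_wpM2r ?powR_ge0// le_max lexx orbT.
rewrite unlock.
apply: (@le_trans _ _ (((Lam `^ r * (C * N `^ (theta - 1)))%:E `^ r^-1)%E)).
  apply: gt0_ler_poweR => //.
  - by rewrite invr_ge0 ltW.
  - rewrite in_itv; apply/andP; split; last exact: leey.
    by apply: integral_ge0 => t _; exact: poweR_ge0.
  - by rewrite in_itv/= leey andbT lee_fin !mulr_ge0 ?powR_ge0// (le_trans ler01).
rewrite poweR_EFin lee_fin !powRM ?mulr_ge0 ?powR_ge0 ?(le_trans ler01 C1)//.
rewrite -!powRrM mulfV ?gt_eqF// powRr1// mulrC ler_wpM2r//.
rewrite ler_wpM2r ?powR_ge0// ler1_powR//.
by rewrite invf_le1.
Qed.
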